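(* Let a fluid vorticity field $q(\cdot)=\{q_s\}_{t\le s\le T}$ be given, and let $$\mathcal U(\rho,t;q(\cdot))=\inf_{\rho(\cdot),\alpha(\cdot)}\left(\int G(x,q_T)\rho_T(x)\,dx+\int_t^T\int\left[\tfrac12|\alpha_s(x)|^2+F(x,q_s)\right]\rho_s(x)\,dx\,ds\right),$$ subject to $\partial_s\rho_s+\nabla\cdot[(\mathcal Tq_s+\alpha_s)\rho_s]=D\Delta\rho_s$ for $t\le s\le T$ and $\rho_t=\rho$, be the optimal value function of the MFG-1 model. Suppose its minimizer is the classical solution $(\rho_s,\phi_s)$ (with control $\alpha_s=\nabla\phi_s$) of the MFG-1 system $$\partial_s\rho_s+\nabla\cdot[(\mathcal Tq_s+\nabla\phi_s)\rho_s]=D\Delta\rho_s,\qquad\rho_t(x)=\rho(x),$$ $$\partial_s\phi_s+\tfrac12|\nabla\phi_s|^2+\nabla\phi_s\cdot\mathcal Tq_s+D\Delta\phi_s=F(x,q_s),\qquad\phi_T(x)=-G(x,q_T),$$ for $t\le s\le T$. Then $$\phi_t=-\frac{\delta\mathcal U}{\delta\rho}(\rho_t,x,t;q(\cdot))\qquad\text{for any }t\le T,$$ and the value function satisfies the functional Hamilton-Jacobi equation $$\partial_t\mathcal U(\rho,t;q(\cdot))-\mathcal H_1\left(\rho,-\frac{\delta\mathcal U}{\delta\rho}(\rho,x,t;q(\cdot));q_t\right)=0,\quad\forall\,t\le T,\qquad \mathcal U(\rho,T;q(\cdot))=\int G(x,q_T)\rho(x)\,dx,$$ where $$\mathcal H_1(\rho,\phi;q)=\int\left[\tfrac12|\nabla\phi|^2+\nabla\phi\cdot\mathcal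 Tq(x)+D\Delta\phi-F(x,q)\right]\rho(x)\,dx.$$
   Context: The spatial domain is the torus $\mathbb T^d$ (with $d\le2$), all spatial integrals are over it, $D$ is the diffusion coefficient and $T$ is the terminal time. $\mathcal T$ is an (invertible) linear operator sending a scalar vorticity field $q$ to the velocity field $u=\mathcal Tq$, which is incompressible: $\nabla\cdot\mathcal Tq=0$. $F(x,q)$ and $G(x,q)$ are the running and terminal cost functions, which may depend on $q$ locally or globally. The notation $\mathcal U(\rho,t;q(\cdot))$ indicates that $\mathcal U$ depends on the whole given (absolutely continuous) curve $\{q_s\}_{t\le s\le T}$, while it depends on $\rho$ only through the initial state $\rho_t=\rho$. $\frac{\delta\mathcal U}{\delta\rho}(\rho,x,t;q(\cdot))$ is the first variation (functional derivative) of $\mathcal U$ in $\rho$, as a function of $x$, with the curve $q(\cdot)$ fixed; $\partial_t$ is likewise taken with $q(\cdot)$ fixed. No function spaces are specified; equations and functional derivatives are understood in the classical sense. *)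

(* Defs.v *)
From HB Require Import structures.
From mathcomp Require Import all_boot all_order all_algebra.
From mathcomp Require Import all_classical all_reals all_analysis.

Set Implicit Arguments.
Unset Strict Implicit.
Unset Printing Implicit Defensive.

Import Order.TTheory GRing.Theory Num.Theory.
Import numFieldNormedType.Exports.

Local Open Scope classical_set_scope.
Local Open Scope ring_scope.

(* Functions on the torus T^d = R^d / Z^d are Z^d-periodic functions on R^d. *)
Section Torus.
Context {R : realType} {d : nat}.
Implicit Types (f g : 'rV[R]_d -> R) (u v : 'rV[R]_d -> 'rV[R]_d).

Definition unit_vec (i : 'I_d) : 'rV[R]_d := delta_mx 0 i.

Definition torus_periodic {A : Type} (f : 'rV[R]_d -> A) : Prop :=
  forall (x : 'rV[R]_d) (i : 'I_d), f (x + unit_vec i) = f x.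

Definition partial_d (i : 'I_d) f : 'rV[R]_d -> R := fun x => 'D_(unit_vec i) f x.

Definition vcoord v (i : 'I_d) : 'rV[R]_d -> R := fun x => v x 0 i.

Definition grad f : 'rV[R]_d -> 'rV[R]_d := fun x => \row_i partial_d i f x.

Definition divg v : 'rV[R]_d -> R := fun x => \sum_i partial_d i (vcoord v i) x.

Definition lap f : 'rV[R]_d -> R := fun x => \sum_i partial_d i (partial_d i f) x.

Definition dotv (a b : 'rV[R]_d) : R := \sum_i a 0 i * b 0 i.

(* The norm of the library on row vectors is the sup norm, whence this one. *)
Definition sqnorm (a : 'rV[R]_d) : R := dotv a a.

Definition C1 f : Prop :=
  continuous f /\
  forall i, (forall x, derivable f x (unit_vec i)) /\ continuous (partial_d i f).

Definition C2 f : Prop := C1 f /\ forall i, C1 (partial_d i f).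

End Torus.

(* Integration over T^d, i.e. over the cube [0, 1]^d, coordinate by coordinate;
   the library has no Lebesgue measure on R^d. *)
Fixpoint torus_int {R : realType} (d : nat) : ('rV[R]_d -> R) -> R :=
  match d with
  | 0%N => fun f => f 0
  | m.+1 => fun f =>
      \int[lebesgue_measure]_(a in `[0, 1])
        torus_int (fun y : 'rV[R]_m => f (row_mx (a%:M : 'M[R]_1) y))
  end.

Section SpaceTime.
Context {R : realType} {d : nat}.

(* l is the derivative at s of g restricted to [a, b]: one-sided when s = a or
   s = b. When a = b the filter is improper and every l qualifies. *)
Definition is_deriv_on (a b : R) (g : R -> R) (s l : R) : Prop :=
  (r - s)^-1 * (g r - g s) @[r --> within `[a, b] s^'] --> l.

Definition jointly_continuous (a b : R) (f : R -> 'rV[R]_d -> R) : Prop :=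
  {within [set z : R * 'rV[R]_d | a <= z.1 <= b],
    continuous (fun z => f z.1 z.2)}.

(* Class C^{1,2} on [a, b] x T^d, up to the boundary in time. *)
Definition C12 (a b : R) (f : R -> 'rV[R]_d -> R) : Prop :=
  [/\ forall s, a <= s <= b -> torus_periodic (f s) /\ C2 (f s),
      jointly_continuous a b f,
      forall i, jointly_continuous a b (fun s => partial_d i (f s)),
      forall i j,
        jointly_continuous a b (fun s => partial_d j (partial_d i (f s))) &
      exists2 ft : R -> 'rV[R]_d -> R, jointly_continuous a b ft &
        forall s x, a <= s <= b -> is_deriv_on a b (f^~ x) s (ft s x)].

Definition abs_continuous_curve {V : normedModType R} (a b : R) (q : R -> V) :
    Prop :=
  forall e : R, 0 < e -> exists2 dl : R, 0 < dl &
    forall (n : nat) (l r : 'I_n -> R),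
      (forall i, a <= l i /\ l i <= r i /\ r i <= b) ->
      (forall i j, i != j -> r i <= l j \/ r j <= l i) ->
      \sum_i (r i - l i) < dl ->
      \sum_i `|q (r i) - q (l i)| < e.

End SpaceTime.

Section FirstVariation.
Context {R : realType} {d : nat}.
Implicit Types (rho g : 'rV[R]_d -> R) (J : ('rV[R]_d -> R) -> R).

(* Densities are nonnegative but their mass is not normalized to 1: this makes
   first variations unique, and not only unique up to an additive constant. *)
Definition density rho : Prop :=
  [/\ torus_periodic rho, C2 rho & forall x, 0 <= rho x].

(* The convex set of densities has boundary points, so that derivatives are
   taken from rho in the direction of another density. *)
Definition is_first_variation J rho g : Prop :=
  [/\ torus_periodic g, continuous g &
      forall rho', density rho' ->
        e^-1 * (J (fun x => rho x + e * (rho' x - rho x)) - J rho) @[e --> 0^'+]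
          --> torus_int (fun x => g x * (rho' x - rho x))].

Definition has_first_variation J rho : Prop :=
  exists g, is_first_variation J rho g.

Definition first_variation J rho : 'rV[R]_d -> R :=
  xget (fun=> 0) [set g | is_first_variation J rho g].

End FirstVariation.

Section MFG1.
Context {R : realType} {d : nat} {V : normedModType R}.
Variables (D T : R) (vel : V -> 'rV[R]_d -> 'rV[R]_d).
Variables (F G : 'rV[R]_d -> V -> R) (q : R -> V).
Implicit Types (rho : 'rV[R]_d -> R) (r phi : R -> 'rV[R]_d -> R).
Implicit Types (alpha : R -> 'rV[R]_d -> 'rV[R]_d).

Definition fokker_planck (t : R) rho r alpha : Prop :=
  (forall s x, t <= s <= T ->
     exists2 rs, is_deriv_on t T (r^~ x) s rs &
       rs + divg (fun y => r s y *: (vel (q s) y + alpha s y)) x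
         = D * lap (r s) x)
  /\ r t = rho.

Definition hj_equation (t : R) phi : Prop :=
  (forall s x, t <= s <= T ->
     exists2 ps, is_deriv_on t T (phi^~ x) s ps &
       ps + 2^-1 * sqnorm (grad (phi s) x)
         + dotv (grad (phi s) x) (vel (q s) x) + D * lap (phi s) x
         = F x (q s))
  /\ (forall x, phi T x = - G x (q T)).

Definition mfg1_solution (t : R) rho r phi : Prop :=
  [/\ C12 t T r, C12 t T phi,
      fokker_planck t rho r (fun s => grad (phi s)) & hj_equation t phi].

Definition admissible (t : R) rho r alpha : Prop :=
  [/\ C12 t T r,
      forall s, t <= s <= T -> density (r s),
      forall s, t <= s <= T ->
        torus_periodic (alpha s) /\ forall i, C1 (vcoord (alpha s) i),
      forall i, jointly_continuous t T (fun s => vcoord (alpha s) i) &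
      fokker_planck t rho r alpha].

Definition cost (t : R) r alpha : R :=
  torus_int (fun x => G x (q T) * r T x)
  + \int[lebesgue_measure]_(s in `[t, T])
      torus_int (fun x =>
        (2^-1 * sqnorm (alpha s x) + F x (q s)) * r s x).

(* The infimum of a set of reals is 0 by convention when the set is empty or
   not bounded below; neither occurs when there is a minimizer. *)
Definition value (rho : 'rV[R]_d -> R) (t : R) : R :=
  inf [set c | exists r alpha, admissible t rho r alpha /\ c = cost t r alpha].

Definition is_minimizer (t : R) rho r alpha : Prop :=
  admissible t rho r alpha /\
  forall r' alpha', admissible t rho r' alpha' ->
    cost t r alpha <= cost t r' alpha'.

Definition hamiltonian1 (rho phi : 'rV[R]_d -> R) (w : V) : R :=
  torus_int (fun x =>
    (2^-1 * sqnorm (grad phi x) + dotv (grad phi x) (vel w x)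
       + D * lap phi x - F x w) * rho x).

End MFG1.

(* Main.v *)
Require Import Defs.
From HB Require Import structures.
From mathcomp Require Import all_boot all_order all_algebra.
From mathcomp Require Import all_classical all_reals all_analysis.
From mathcomp Require Import ring lra.
Import Order.TTheory GRing.Theory Num.Theory.
Import numFieldNormedType.Exports.
Local Open Scope classical_set_scope.
Local Open Scope ring_scope.

(** The Hamilton-Jacobi equation for [phi] does not involve [rho], and by the
    maximum principle it has a single solution.  Along a solution of the MFG-1
    system, the derivative in time of [int phi_s rho_s] is, after integration by
    parts, the running cost, so that the optimal cost is [- int phi_t rho].
    Hence the value function is linear in [rho] with kernel [- phi_t]: this
    kernel is its first variation (unique, by testing against localized
    densities), and differentiating under the integral gives the functional
    equation. *)

Set Implicit Arguments.
Unset Strict Implicit.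
Unset Printing Implicit Defensive.

(** * Continuous functions and their integrals over the torus *)

Section ContinuousAlgebra.
Context {R : realType} {T : topologicalType}.
Implicit Types f g : T -> R.

(** The hypothesis provides a separate solution for each density and each initial time, and nothing
    in it says that [phi] is shared by different densities. Linearity of the value in [rho] depends
    on exactly this, hence the comparison argument. A solution on [[t0, T]] also restricts to every
    [[s, T]], so that one [phi] gives the value at all later times with [rho] frozen; this is what
    makes the time derivative computable.

    Three features of the definitions shape the rest. The integral over the torus is an iterated
    one-dimensional integral, so its laws come by induction on the dimension, for continuous
    integrands, and limits pass under it by uniform convergence on the compact cube. Time
    derivatives are limits within a closed interval, one-sided at its ends and void when it is a
    point, so they need a small calculus of their own and a separate treatment of the terminal time.
    First variations are tested only towards densities, which are nonnegative and of class C^2, so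
    that localization requires explicit periodic bumps of this class. *)

Lemma continuous_cst (c : R) : continuous (fun _ : T => c).
Proof. exact: cst_continuous. Qed.

Lemma continuous_add f g : continuous f -> continuous g ->
  continuous (fun x => f x + g x).
Proof. by move=> cf cg x; apply: (@continuousD _ _ _ f g x); [exact: cf | exact: cg]. Qed.

Lemma continuous_opp f : continuous f -> continuous (fun x => - f x).
Proof. by move=> cf x; apply: (@continuousN _ _ _ f x); exact: cf. Qed.

Lemma continuous_mul f g : continuous f -> continuous g ->
  continuous (fun x => f x * g x).
Proof. by move=> cf cg x; apply: (@continuousM _ _ f g x); [exact: cf | exact: cg]. Qed.

Lemma continuous_sub f g : continuous f -> continuous g ->
  continuous (fun x => f x - g x).
Proof. by move=> cf cg; apply: continuous_add => //; exact: continuous_opp. Qed.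

Lemma continuous_sum (I : finType) (F : I -> T -> R) :
  (forall i, continuous (F i)) -> continuous (fun x => \sum_i F i x).
Proof.
move=> cF; elim: (index_enum I) => [|i s IH].
  by under eq_fun do rewrite big_nil; exact: continuous_cst.
by under eq_fun do rewrite big_cons; exact: continuous_add.
Qed.

End ContinuousAlgebra.

Lemma cvg_mx {R : realType} {I : Type} (F : set_system I) {FF : Filter F} m n
    (M : I -> 'M[R]_(m, n)) (A : 'M[R]_(m, n)) :
  (forall i j, M p i j @[p --> F] --> A i j) -> M p @[p --> F] --> A.
Proof.
move=> MA; apply/cvgrPdist_lt => e e0.
have K : \forall p \near F, forall ij : 'I_m * 'I_n, `|A ij.1 ij.2 - M p ij.1 ij.2| < e.
  apply: filter_forall => -[i j] /=.
  by have /cvgrPdist_lt/(_ e e0) := MA i j.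
near=> p; rewrite [ltLHS]mx_normrE.
apply/bigmax_ltP; split => // -[i j] _ /=.
rewrite !mxE; have := near K p; move=> /(_ _)/(_ (i, j)); exact.
Unshelve. all: by end_near. Qed.

Definition cube {R : realType} d : set 'rV[R]_d :=
  [set x | forall i, x ord0 i \in `[0, 1]].
Arguments cube {R} d _.

Section TorusInt.
Context {R : realType}.

Lemma compact_cube d : compact (@cube R d).
Proof.
by apply: (@rV_compact R d (fun=> `[0, 1]%classic)) => i; exact: segment_compact. Qed.

(** This is the argument built in the recursion of [torus_int], so that an integral in dimension
    [m.+1] unfolds to it by conversion. *)
Definition cons_rv {m} (a : R) (y : 'rV[R]_m) : 'rV[R]_m.+1 :=
  row_mx (a%:M : 'M[R]_1) y.

Lemma cons_rv0 m a (y : 'rV[R]_m) : cons_rv a y ord0 ord0 = a.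
Proof.
rewrite (_ : cons_rv a y ord0 ord0 = cons_rv a y ord0 (lshift m (ord0 : 'I_1))).
  by rewrite [LHS]row_mxEl mxE.
by congr (_ _ _); apply/val_inj.
Qed.

Lemma cons_rvS m a (y : 'rV[R]_m) j : cons_rv a y ord0 (lift ord0 j) = y ord0 j.
Proof.
rewrite (_ : cons_rv a y ord0 _ = cons_rv a y ord0 (rshift 1 j)).
  by rewrite [LHS]row_mxEr.
by congr (_ _ _); apply/val_inj.
Qed.

Lemma cons_rv_cube m a (y : 'rV[R]_m) :
  cube m.+1 (cons_rv a y) <-> a \in `[0, 1] /\ cube m y.
Proof.
split=> [c|[a01 c] i].
  by split=> [|i]; [rewrite -(cons_rv0 a y) | rewrite -(cons_rvS a y)]; exact: c.
by case: (unliftP ord0 i) => [j ->|->]; rewrite ?cons_rv0 ?cons_rvS //; exact: c.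
Qed.

Lemma cons_rvK m (x : 'rV[R]_m.+1) :
  x = cons_rv (x ord0 ord0) (\row_j x ord0 (lift ord0 j)).
Proof.
apply/rowP => i; case: (unliftP ord0 i) => [j ->|->].
  by rewrite cons_rvS mxE.
by rewrite cons_rv0.
Qed.

Lemma cvg_cons_rv {I : Type} (F : set_system I) {FF : Filter F} m
    (a : I -> R) (y : I -> 'rV[R]_m) a0 y0 :
  a p @[p --> F] --> a0 -> y p @[p --> F] --> y0 ->
  cons_rv (a p) (y p) @[p --> F] --> cons_rv a0 y0.
Proof.
move=> aa yy; apply: cvg_mx => i; rewrite ord1 => j.
case: (unliftP ord0 j) => [k ->|->].
  under eq_fun do rewrite cons_rvS.
  rewrite cons_rvS.
  by apply: (@cvg_comp _ _ _ y (fun v => v ord0 k) _ _ _ yy); exact: coord_continuous.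
under eq_fun do rewrite cons_rv0.
by rewrite cons_rv0.
Qed.

Lemma continuous_cons_rv m (f : 'rV[R]_m.+1 -> R) :
  continuous f -> continuous (fun z : R * 'rV[R]_m => f (cons_rv z.1 z.2)).
Proof.
move=> cf z; apply: (@cvg_comp _ _ _ (fun z => cons_rv z.1 z.2) f); last exact: cf.
by apply: cvg_cons_rv; [exact: cvg_fst | exact: cvg_snd].
Qed.

Lemma continuous_slice {P T U : topologicalType} (f : P -> T -> U) p :
  continuous (fun z => f z.1 z.2) -> continuous (f p).
Proof.
move=> cf y.
apply: (@cvg_comp _ _ _ (fun y => (p, y)) (fun z => f z.1 z.2)); last exact: (cf (p, y)).
by apply: cvg_pair => /=; [exact: cvg_cst | exact: cvg_id].
Qed.

Lemma continuous_slicel {P T U : topologicalType} (f : P -> T -> U) y :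
  continuous (fun z => f z.1 z.2) -> continuous (f^~ y).
Proof.
move=> cf p.
apply: (@cvg_comp _ _ _ (fun p => (p, y)) (fun z => f z.1 z.2)); last exact: (cf (p, y)).
by apply: cvg_pair => /=; [exact: cvg_id | exact: cvg_cst].
Qed.

(* The elementary laws of the integral of continuous functions, bundled for
   the induction on the dimension. *)
Definition torus_int_laws d : Prop :=
  [/\ forall f g : 'rV[R]_d -> R, continuous f -> continuous g ->
        torus_int (fun x => f x + g x) = torus_int f + torus_int g,
      forall (c : R) (f : 'rV[R]_d -> R), continuous f ->
        torus_int (fun x => c * f x) = c * torus_int f,
      forall f g : 'rV[R]_d -> R, continuous f -> continuous g ->
        (forall x, cube d x -> f x <= g x) -> torus_int f <= torus_int g &
      forall c : R, torus_int (fun _ : 'rV[R]_d => c) = c].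

(** Convergence is assumed jointly in the parameter and near each point; compactness of the cube
    makes it uniform there, and then [f p] and [f0] differ by at most the constant [e] under the
    integral. The laws are a hypothesis because the induction that proves them uses this lemma one
    dimension lower. *)
Lemma laws_cvg_torus_int d {I : Type} (F : set_system I) {FF : Filter F}
    (f : I -> 'rV[R]_d -> R) (f0 : 'rV[R]_d -> R) :
  torus_int_laws d ->
  (\forall p \near F, continuous (f p)) -> continuous f0 ->
  (forall x, cube d x -> f z.1 z.2 @[z --> (F, nbhs x)] --> f0 x) ->
  torus_int (f p) @[p --> F] --> torus_int f0.
Proof.
move=> [iD iZ ile icst] cf cf0 ff0; apply/cvgrPdist_le => e e0.
have K : \forall p \near F, forall x, cube d x -> `|f p x - f0 x| <= e.
  have /compact_near_coveringP cc := @compact_cube d.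
  apply: (cc I F (fun p x => `|f p x - f0 x| <= e)) => x cx.
  have e2 : 0 < e / 2 by rewrite divr_gt0.
  have /cvgrPdist_le/(_ _ e2) := ff0 _ cx.
  pose A := [set y | `|f0 x - f0 y| <= e / 2].
  have nA : nbhs x A by have /cvgrPdist_le/(_ _ e2) := cf0 x.
  move=> [] /= [U V] /= [FU nV] UV.
  exists (A `&` V, U) => /=; first by split=> //; exact: filterI.
  move=> [y p] /= [[Ay Vy] Up].
  have : `|f0 x - f0 y| <= e / 2 by exact: Ay.
  have := UV (p, y) (conj Up Vy) => /=.
  move=> h1 h2; rewrite -(subrK (f0 x) (f p y)) -addrA.
  rewrite (le_trans (ler_normD _ _))// [leRHS](splitr e) lerD//.
  by rewrite distrC.
near=> p.
have cfp : continuous (f p) by near: p.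
have Kp : forall x, cube d x -> `|f p x - f0 x| <= e by near: p.
have h1 : torus_int (f p) <= torus_int f0 + e.
  rewrite -[X in _ <= _ + X]icst -iD//; last exact: continuous_cst.
  apply: ile => //; first by apply: continuous_add => //; exact: continuous_cst.
  by move=> x cx; have := Kp x cx; rewrite ler_norml lerBlDl => /andP[].
have h2 : torus_int f0 <= torus_int (f p) + e.
  rewrite -[X in _ <= _ + X]icst -iD//; last exact: continuous_cst.
  apply: ile => //; first by apply: continuous_add => //; exact: continuous_cst.
  by move=> x cx; have := Kp x cx; rewrite ler_norml lerNl opprB lerBlDl => /andP[].
by rewrite ler_distl; apply/andP; split; rewrite ?lerBlDr.
Unshelve. all: by end_near. Qed.

Lemma laws_continuous_torus_int d {P : topologicalType} (f : P -> 'rV[R]_d -> R) :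
  torus_int_laws d -> continuous (fun z : P * 'rV[R]_d => f z.1 z.2) ->
  continuous (fun p => torus_int (f p)).
Proof.
move=> H cf p; apply: laws_cvg_torus_int => //.
- by near=> q; exact: (@continuous_slice _ _ _ f q cf).
- exact: (@continuous_slice _ _ _ f p cf).
- by move=> x _; exact: (cf (p, x)).
Unshelve. all: by end_near. Qed.

Notation mu := (@lebesgue_measure R).

Lemma continuous_integrable01 (f : R -> R) :
  continuous f -> mu.-integrable `[0, 1] (EFin \o f).
Proof.
move=> cf; apply: continuous_compact_integrable; first exact: segment_compact.
exact: continuous_subspaceT.
Qed.

(** The outer integral obeys these laws only if the inner one is integrable in the first coordinate.
    It is even continuous there, by the laws in dimension [m] applied with that coordinate as the
    parameter. *)
Lemma torus_int_lawsP d : torus_int_laws d.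
Proof.
elim: d => [|m IH].
  split=> //= f g cf cg fg; apply: fg => i; by case: i.
have cI (f : 'rV[R]_m.+1 -> R) : continuous f ->
    continuous (fun a => torus_int (fun y => f (cons_rv a y))).
  move=> cf.
  exact: (@laws_continuous_torus_int m R (fun a y => f (cons_rv a y)) IH
    (continuous_cons_rv cf)).
have cs (f : 'rV[R]_m.+1 -> R) a : continuous f ->
    continuous (fun y => f (cons_rv a y)).
  move=> /continuous_cons_rv.
  exact: (@continuous_slice _ _ _ (fun a y => f (cons_rv a y)) a).
have iI (f : 'rV[R]_m.+1 -> R) : continuous f -> mu.-integrable `[0, 1]
    (EFin \o (fun a => torus_int (fun y => f (cons_rv a y)))).
  by move=> cf; apply: continuous_integrable01; exact: (cI f cf).
case: IH => iD iZ ile icst; split=> /=.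
- move=> f g cf cg; rewrite -RintegralD//; [|exact: (iI f cf)|exact: (iI g cg)].
  by apply: eq_Rintegral => a _; rewrite -iD//; [exact: (cs f)|exact: (cs g)].
- move=> c f cf; rewrite -RintegralZl//; last exact: (iI f cf).
  by apply: eq_Rintegral => a _; rewrite -iZ//; exact: (cs f).
- move=> f g cf cg fg; apply: le_Rintegral => //; [exact: (iI f cf)|exact: (iI g cg)|].
  move=> a a01; apply: ile; [exact: (cs f)|exact: (cs g)|] => y cy.
  by apply: fg; apply/cons_rv_cube; split.
- move=> c; under eq_Rintegral do rewrite icst.
  rewrite Rintegral_cst //= lebesgue_measure_itv /= lte_fin ltr01.
  by rewrite -EFinB/= subr0 mulr1.
Qed.

End TorusInt.

Section TorusIntTheory.
Context {R : realType}.
Notation mu := (@lebesgue_measure R).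

Section Laws.
Context {d : nat}.
Implicit Types f g : 'rV[R]_d -> R.

Lemma torus_intD f g : continuous f -> continuous g ->
  torus_int (fun x => f x + g x) = torus_int f + torus_int g.
Proof. by case: (@torus_int_lawsP R d) => + _ _ _; apply. Qed.

Lemma torus_intZ (c : R) f : continuous f ->
  torus_int (fun x => c * f x) = c * torus_int f.
Proof. by case: (@torus_int_lawsP R d) => _ + _ _; apply. Qed.

Lemma torus_intN f : continuous f -> torus_int (fun x => - f x) = - torus_int f.
Proof.
move=> cf; rewrite -mulN1r -torus_intZ//.
by congr torus_int; apply/funext => x; rewrite mulN1r.
Qed.

Lemma torus_intB f g : continuous f -> continuous g ->
  torus_int (fun x => f x - g x) = torus_int f - torus_int g.
Proof.
move=> cf cg; rewrite -torus_intN//; apply: torus_intD => //.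
exact: continuous_opp.
Qed.

Lemma le_torus_int f g : continuous f -> continuous g ->
  (forall x, cube d x -> f x <= g x) -> torus_int f <= torus_int g.
Proof. by case: (@torus_int_lawsP R d) => _ _ + _; apply. Qed.

Lemma torus_int_cst (c : R) : torus_int (fun _ : 'rV[R]_d => c) = c.
Proof. by case: (@torus_int_lawsP R d) => _ _ _ +; apply. Qed.

Lemma torus_int_sum (I : finType) (F : I -> 'rV[R]_d -> R) :
  (forall i, continuous (F i)) ->
  torus_int (fun x => \sum_i F i x) = \sum_i torus_int (F i).
Proof.
move=> cF; elim: (index_enum I) => [|i s IH].
  by under eq_fun do rewrite big_nil; rewrite big_nil torus_int_cst.
under eq_fun do rewrite big_cons; rewrite torus_intD ?IH ?big_cons//.
elim: s {IH} => [|j s IH].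
  by under eq_fun do rewrite big_nil; exact: continuous_cst.
by under eq_fun do rewrite big_cons; exact: continuous_add.
Qed.

End Laws.

Lemma Rintegral01_gt0 (f : R -> R) (c : R) : continuous f ->
  (forall x, x \in `[0, 1] -> 0 <= f x) -> c \in `[0, 1] -> 0 < f c ->
  0 < \int[mu]_(x in `[0, 1]) f x.
Proof.
move=> cf f0 c01 fc0.
have fc2 : 0 < f c / 2 by rewrite divr_gt0.
have /cvgrPdist_le/(_ _ fc2) [e /= e0 fe] := cf c.
(* Truncation to [[0, 1]] leaves an interval of positive length even when [c] is an end point; on it
   [f] is at least [f c / 2]. *)
pose l := Num.max 0 (c - e / 2); pose r := Num.min 1 (c + e / 2).
move: c01; rewrite in_itv/= => /andP[c0 c1].
have lr : l < r.
  by rewrite /l /r lt_min !gt_max; apply/andP; split; apply/andP; split; lra.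
have lrs : `[l, r]%classic `<=` `[0, 1].
  move=> x /=; rewrite !in_itv/= /l /r ge_max le_min => /andP[/andP[-> _] /andP[-> _]] //.
have int01 := continuous_integrable01 cf.
have intlr : mu.-integrable `[l, r] (EFin \o f) by exact: integrableS int01.
apply: (@lt_le_trans _ _ (\int[mu]_(x in `[l, r]) f x)).
  apply: (@lt_le_trans _ _ (\int[mu]_(x in `[l, r]) (f c / 2))).
    rewrite Rintegral_cst //= lebesgue_measure_itv /= lte_fin lr -EFinB /=.
    by rewrite mulr_gt0// subr_gt0.
  apply: le_Rintegral => //.
    have cc : continuous (fun _ : R => f c / 2) by exact: continuous_cst.
    by apply: integrableS (continuous_integrable01 cc).
  move=> x; rewrite /= in_itv/= /l /r ge_max le_min => /andP[/andP[_ xl] /andP[_ xr]].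
  have /fe : ball_ Num.norm c e x by rewrite /ball_/= ltr_norml; apply/andP; split; lra.
  by rewrite ler_norml => /andP[_]; lra.
apply: fine_le.
- exact: integrable_fin_num.
- exact: integrable_fin_num.
- by apply: ge0_subset_integral => //; case/integrableP : int01.
Qed.

Lemma torus_int_gt0 d (f : 'rV[R]_d -> R) (a : 'rV[R]_d) : continuous f ->
  (forall x, cube d x -> 0 <= f x) -> cube d a -> 0 < f a ->
  0 < torus_int f.
Proof.
elim: d f a => [f a|m IH f a] cf f0 ca fa0 /=.
  by rewrite (_ : 0 = a)//; apply/rowP => -[].
have cc := continuous_cons_rv cf.
move: ca fa0; rewrite (cons_rvK a) cons_rv_cube => -[a01 ca] fa0.
apply: (@Rintegral01_gt0 _ (a ord0 ord0)) => //.
- apply: (@laws_continuous_torus_int _ m R (fun a y => f (cons_rv a y))) => //.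
  exact: torus_int_lawsP.
- move=> b b01; rewrite -(@torus_int_cst m 0).
  apply: le_torus_int; first exact: continuous_cst.
    exact: (@continuous_slice _ _ _ (fun a y => f (cons_rv a y))).
  by move=> x cx; apply: f0; rewrite cons_rv_cube.
- apply: (IH _ (\row_j a ord0 (lift ord0 j))) => //.
    exact: (@continuous_slice _ _ _ (fun a y => f (cons_rv a y))).
  by move=> x cx; apply: f0; rewrite cons_rv_cube.
Qed.

(* Composing with [clamp a b] turns joint continuity on [a, b] into joint
   continuity everywhere. *)
Definition clamp (a b s : R) := Num.max a (Num.min s b).

Lemma clamp_itv a b s : a <= b -> a <= clamp a b s <= b.
Proof. by move=> ab; rewrite /clamp le_max ge_max ge_min lexx ab/= lexx orbT. Qed.

Lemma clampK a b s : a <= s <= b -> clamp a b s = s.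
Proof. by move=> /andP[sa sb]; rewrite /clamp min_l// max_r. Qed.

Lemma continuous_clamp a b : continuous (clamp a b).
Proof.
move=> x; apply/cvgrPdist_lt => e e0; exists e => //= y.
rewrite /ball_/=; apply: le_lt_trans; rewrite /clamp.
rewrite ler_norml.
have h0 := ler_norm (x - y).
have h0' : y - x <= `|x - y| by rewrite distrC ler_norm.
by case: (leP x b) => h1; case: (leP y b) => h2; case: (leP a b) => h3;
  do ?case: (leP a x) => h4; do ?case: (leP a y) => h5; apply/andP; split; lra.
Qed.

Lemma jointly_continuous_clamp d a b (f : R -> 'rV[R]_d -> R) : a <= b ->
  jointly_continuous a b f ->
  continuous (fun z : R * 'rV[R]_d => f (clamp a b z.1) z.2).
Proof.
move=> ab /subspace_continuousP cf z.
have cz : [set z : R * 'rV[R]_d | a <= z.1 <= b] (clamp a b z.1, z.2).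
  exact: clamp_itv.
have cK : (clamp a b z.1, z.2) @[z --> z] --> (clamp a b z.1, z.2).
  have c1 : clamp a b z0.1 @[z0 --> z] --> clamp a b z.1.
    apply: (@cvg_comp _ _ _ fst (clamp a b)); first exact: cvg_fst.
    exact: continuous_clamp.
  have c2 : z0.2 @[z0 --> z] --> z.2 by exact: cvg_snd.
  exact: cvg_pair c1 c2.
apply: (@cvg_comp _ _ _ (fun z => (clamp a b z.1, z.2)) (fun z => f z.1 z.2)
  _ _ _ _ (cf _ cz)) => A nA.
have h : \forall w \near z, a <= clamp a b w.1 <= b -> A (clamp a b w.1, w.2) := cK _ nA.
suff : \forall w \near z, A (clamp a b w.1, w.2) by [].
by apply: filterS h => w; apply; exact: clamp_itv.
Qed.

Lemma jointly_continuous_slice d a b (f : R -> 'rV[R]_d -> R) s :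
  a <= s <= b -> jointly_continuous a b f -> continuous (f s).
Proof.
move=> asb /jointly_continuous_clamp cf.
have ab : a <= b by case/andP: asb => /le_trans; apply.
have := @continuous_slice _ _ _ (fun s x => f (clamp a b s) x) s (cf ab).
by rewrite clampK.
Qed.

Lemma within_continuous_torus_int d a b (f : R -> 'rV[R]_d -> R) : a <= b ->
  jointly_continuous a b f ->
  {within `[a, b], continuous (fun s => torus_int (f s))}.
Proof.
move=> ab /(jointly_continuous_clamp ab) cf.
apply: (@subspace_eq_continuous _ _ _ (fun s => torus_int (f (clamp a b s)))).
  by move=> s; rewrite inE /= in_itv/= => asb; rewrite clampK.
apply: continuous_subspaceT.
apply: (@laws_continuous_torus_int _ d R (fun s => f (clamp a b s))) => //.
exact: torus_int_lawsP.
Qed.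

(** * Derivatives on a closed interval and differentiation under the integral *)

Lemma is_deriv_on_is_derive a b (g : R -> R) s l :
  s \in `]a, b[ -> is_deriv_on a b g s l -> is_derive s 1 g l.
Proof.
rewrite in_itv/= => /andP[sa sb] gs.
have K : (fun h => h^-1 *: ((g \o shift s) (h *: 1) - g s)) h @[h --> 0^'] --> l.
  have gs' : (h + s) @[h --> 0^'] --> within `[a, b] s^'.
    move=> A /= [e /= e0 eA].
    pose e' := Num.min e (Num.min (s - a) (b - s)).
    have e'0 : 0 < e' by rewrite !lt_min e0 !subr_gt0 sa.
    exists e' => //= h; rewrite /ball_/= sub0r normrN /e' !lt_min.
    move=> /and3P[he]; rewrite !ltr_norml => /andP[h1 h2] /andP[h3 h4] h0.
    apply: eA => /=.
    - by rewrite opprD addrCA subrr addr0 normrN.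
    - by rewrite -subr_eq0 addrK.
    - by rewrite in_itv/=; apply/andP; split; lra.
  have := @cvg_comp _ _ _ (fun h => h + s) _ _ _ _ gs' gs.
  apply: cvg_trans; apply: near_eq_cvg; near=> h => /=.
  by rewrite addrK [h *: 1]mulr1.
apply: DeriveDef; first by apply/cvg_ex; exists l.
exact: (cvg_lim (@Rhausdorff R) K).
Unshelve. all: by end_near. Qed.

(** Both orders of [s] and [r] are covered since the difference quotient is symmetric in them; the
    end points [a] and [b] are allowed because the mean value theorem differentiates only in the
    interior. *)
Lemma is_deriv_on_MVT a b (g g' : R -> R) :
  {within `[a, b], continuous g} ->
  (forall s, a <= s <= b -> is_deriv_on a b g s (g' s)) ->
  forall s r, a <= s <= b -> a <= r <= b -> s != r ->
  exists2 xi, Num.min s r <= xi <= Num.max s r &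
    (r - s)^-1 * (g r - g s) = g' xi.
Proof.
move=> cg dg.
have main s r : a <= s -> r <= b -> s < r ->
    exists2 xi, s <= xi <= r & g r - g s = g' xi * (r - s).
  move=> sa rb sr.
  have [||xi xisr E] := @MVT R g g' s r sr.
  - move=> x; rewrite in_itv/= => /andP[sx xr].
    apply: (@is_deriv_on_is_derive a b); last by apply: dg; lra.
    by rewrite in_itv/=; lra.
  - apply: continuous_subspaceW cg => x /=; rewrite !in_itv/=; lra.
  by exists xi => //; move: xisr; rewrite in_itv/=; lra.
move=> s r /andP[sa sb] /andP[ra rb]; rewrite neq_lt => /orP[] sr.
  have [xi xisr E] := main _ _ sa rb sr.
  exists xi; first by rewrite min_l ?max_r// ltW.
  by rewrite E mulrCA mulVf ?mulr1// subr_eq0 gt_eqF.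
have [xi xisr E] := main _ _ ra sb sr.
exists xi; first by rewrite min_r ?max_l// ltW.
rewrite -opprB invrN mulNr -mulrN opprB E mulrCA mulVf ?mulr1//.
by rewrite subr_eq0 gt_eqF.
Qed.

Lemma is_deriv_on_FTC a b (g g' : R -> R) : a < b ->
  {within `[a, b], continuous g} -> {within `[a, b], continuous g'} ->
  (forall s, a <= s <= b -> is_deriv_on a b g s (g' s)) ->
  \int[mu]_(s in `[a, b]) g' s = g b - g a.
Proof.
move=> ab cg cg' dg.
have dg' s : s \in `]a, b[ -> is_derive s 1 g (g' s).
  move=> sab; apply: (is_deriv_on_is_derive sab); apply: dg.
  by move: sab; rewrite in_itv/=; lra.
rewrite /Rintegral (@continuous_FTC2 R g' g a b)//.
  have [_ ga gb] := (continuous_within_itvP g ab).1 cg.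
  by split => // s /dg'[].
by move=> s /dg' ds; rewrite derive1E derive_val.
Qed.

Section Leibniz.
Context {d : nat}.
Variables (a b : R) (h h' : R -> 'rV[R]_d -> R).
Hypothesis ab : a < b.
Hypothesis ch : jointly_continuous a b h.
Hypothesis ch' : jointly_continuous a b h'.
Hypothesis dh : forall s x, a <= s <= b -> is_deriv_on a b (h^~ x) s (h' s x).

Lemma jointly_continuous_time x : {within `[a, b], continuous (h^~ x)}.
Proof.
apply: (@subspace_eq_continuous _ _ _ (fun s => h (clamp a b s) x)).
  by move=> s; rewrite inE /= in_itv/= => asb; rewrite clampK.
apply: continuous_subspaceT.
apply: (@continuous_slicel _ _ _ (fun s x => h (clamp a b s) x)).
exact: (jointly_continuous_clamp (ltW ab) ch).
Qed.

(* By the mean value theorem the difference quotient is a value of [h'] at an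
   intermediate time, so it converges uniformly on the cube. *)
Lemma is_deriv_on_torus_int s : a <= s <= b ->
  is_deriv_on a b (fun s => torus_int (h s)) s (torus_int (h' s)).
Proof.
move=> asb; rewrite /is_deriv_on.
have cs r : a <= r <= b -> continuous (h r).
  by move=> arb; exact: jointly_continuous_slice ch.
have cq r : a <= r <= b -> continuous (fun x => (r - s)^-1 * (h r x - h s x)).
  move=> arb; apply: continuous_mul; first exact: continuous_cst.
  by apply: continuous_sub; exact: cs.
apply: (@cvg_trans _ (torus_int (fun x => (r - s)^-1 * (h r x - h s x))
    @[r --> within `[a, b] s^'])).
  apply: near_eq_cvg; near=> r.
  have rab : a <= r <= b.
    have : `[a, b]%classic r by near: r; exact: withinT.
    by rewrite /= in_itv.
  have [chr chs] := (cs r rab, cs s asb).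
  by rewrite torus_intZ ?torus_intB//; exact: continuous_sub.
apply: laws_cvg_torus_int.
- exact: torus_int_lawsP.
- near=> r; apply: cq.
  have : `[a, b]%classic r by near: r; exact: withinT.
  by rewrite /= in_itv.
- exact: jointly_continuous_slice ch'.
move=> x _; apply/cvgrPdist_le => e e0 /=.
have ck := jointly_continuous_clamp (ltW ab) ch'.
have /cvgrPdist_le/(_ _ e0) := ck (s, x).
move=> [[U V] /= [[dl /= dl0 dlU] nV] UV].
(* The intermediate time [xi] is no farther from [s] than [r] is, so the ball that controls [h']
   also serves for [r]; the point [s], where there is no quotient, is removed. *)
exists (ball_ Num.norm s dl `&` `[a, b] `&` [set r | r != s], V) => /=.
  split=> //; apply: filterI; first apply: filterI.
  - apply: cvg_within; apply: cvg_within; exact: (nbhsx_ballx s dl dl0).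
  - exact: withinT.
  - by apply: cvg_within; have := @nbhs_dnbhs_neq R s.
move=> [r y] /= [[[sr]]]; rewrite in_itv/= => rab rs Vy.
have sr' : s != r by rewrite eq_sym.
have cy : {within `[a, b], continuous (h^~ y)} by exact: jointly_continuous_time.
have [xi xisr ->] := is_deriv_on_MVT cy (fun s => @dh s y) asb rab sr'.
have xiab : a <= xi <= b /\ `|s - xi| < dl.
  move: sr asb rab xisr; rewrite !ltr_norml => /andP[? ?] /andP[? ?] /andP[? ?].
  by case: (leP s r) => ? /andP[? ?]; split; apply/andP; split; lra.
case: xiab => xiab sxi.
have := UV (xi, y) (conj (dlU xi sxi) Vy).
by rewrite /= !clampK.
Unshelve. all: by end_near. Qed.

Lemma Rintegral_torus_int :
  \int[mu]_(s in `[a, b]) torus_int (h' s) = torus_int (h b) - torus_int (h a).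
Proof.
apply: (is_deriv_on_FTC ab (within_continuous_torus_int (ltW ab) ch)
  (within_continuous_torus_int (ltW ab) ch')).
exact: is_deriv_on_torus_int.
Qed.

End Leibniz.

End TorusIntTheory.

(** * The divergence theorem *)

Section Divergence.
Context {R : realType}.

Lemma cons_rv_unit0 m (a b : R) (y : 'rV[R]_m) :
  cons_rv b y = (b - a) *: unit_vec ord0 + cons_rv a y.
Proof.
apply/rowP => i; rewrite [RHS]mxE [X in _ = X + _]mxE [unit_vec _ _ _]mxE.
case: (unliftP ord0 i) => [j ->|->].
  by rewrite [LHS]cons_rvS [X in _ = _ + X]cons_rvS eqxx /= mulr0 add0r.
by rewrite [LHS]cons_rv0 [X in _ = _ + X]cons_rv0 !eqxx mulr1 subrK.
Qed.

Lemma cons_rv_unitS m (a k : R) (y : 'rV[R]_m) j :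
  cons_rv a (k *: unit_vec j + y) = k *: unit_vec (lift ord0 j) + cons_rv a y.
Proof.
apply/rowP => i; rewrite [RHS]mxE [X in _ = X + _]mxE [unit_vec _ _ _]mxE.
case: (unliftP ord0 i) => [l ->|->].
  rewrite [LHS]cons_rvS [X in _ = _ + X]cons_rvS !mxE.
  by rewrite (inj_eq (@lift_inj _ ord0)).
rewrite [LHS]cons_rv0 [X in _ = _ + X]cons_rv0.
by rewrite (negbTE (neq_lift _ _)) andbF mulr0 add0r.
Qed.

Lemma is_deriv_on_line d (f : 'rV[R]_d -> R) (c : R -> 'rV[R]_d) v a b s :
  (forall r, c r = (r - s) *: v + c s) -> derivable f (c s) v ->
  is_deriv_on a b (f \o c) s ('D_v f (c s)).
Proof.
move=> cE df.
have sK : (r - s) @[r --> within `[a, b] s^'] --> 0^'.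
  move=> A /= [e /= e0 eA].
  exists e => //= r; rewrite /ball_/= => sr rs _.
  apply: eA; rewrite /= ?subr_eq0//.
  by rewrite sub0r normrN distrC.
have := @cvg_comp _ _ _ (fun r => r - s) _ _ _ _ sK df.
apply: cvg_trans; apply: near_eq_cvg; near=> r => /=.
by rewrite (cE r).
Unshelve. all: by end_near. Qed.

(** If [i] is not the first coordinate, the inner integral already vanishes by induction. If it is,
    the fundamental theorem is applied to the inner integral as a function of the first coordinate,
    and periodicity identifies the two faces. *)
Lemma torus_int_partial d (f : 'rV[R]_d -> R) i :
  torus_periodic f -> C1 f -> torus_int (partial_d i f) = 0.
Proof.
(* The induction carries only continuity and the [i]-th partial derivative, since this is what the
   slices are shown to inherit. *)
move=> pf [cf] /(_ i)[].
elim: d f i pf cf => [f []//|m IH] f i pf cf df cdf /=.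
have cc := continuous_cons_rv cf.
have cdc := continuous_cons_rv cdf.
case: (unliftP ord0 i) => [j|] iE.
  transitivity (\int[lebesgue_measure]_(_ in `[0, 1]) (0 : R)); last first.
    by rewrite Rintegral_cst //= mul0r.
  apply: eq_Rintegral => a _.
  pose fa y := f (cons_rv a y).
  have Eq y : (fun h => h^-1 *:
        ((f \o shift (cons_rv a y)) (h *: unit_vec i) - f (cons_rv a y)))
      = (fun h => h^-1 *: ((fa \o shift y) (h *: unit_vec j) - fa y)).
    by apply/funext => k /=; rewrite /fa cons_rv_unitS iE.
  have E : (fun y => partial_d i f (cons_rv a y)) = partial_d j fa.
    by apply/funext => y; rewrite /partial_d /derive Eq.
  rewrite E; apply: IH.
  - move=> y l; rewrite /fa addrC -[unit_vec l]scale1r cons_rv_unitS scale1r addrC.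
    by rewrite pf.
  - exact: (@continuous_slice _ _ _ (fun a y => f (cons_rv a y)) a cc).
  - move=> y; have := df (cons_rv a y); by rewrite /derivable Eq.
  - have := @continuous_slice _ _ _ (fun a y => partial_d i f (cons_rv a y)) a cdc.
    by rewrite E.
have fE := @Rintegral_torus_int _ m 0 1 (fun a y => f (cons_rv a y))
  (fun a y => partial_d i f (cons_rv a y)).
apply: (etrans (fE _ _ _ _)) => //; [exact: continuous_subspaceT..| |].
  move=> s x _; rewrite iE; apply: (@is_deriv_on_line _ f (fun s => cons_rv s x)).
    by move=> r; exact: cons_rv_unit0.
  by rewrite -iE; exact: df.
apply/eqP; rewrite subr_eq0; apply/eqP; congr torus_int; apply/funext => y.
by rewrite (@cons_rv_unit0 _ 0 1) subr0 scale1r addrC pf.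
Qed.

Lemma torus_int_divg d (v : 'rV[R]_d -> 'rV[R]_d) :
  torus_periodic v -> (forall i, C1 (vcoord v i)) -> torus_int (divg v) = 0.
Proof.
move=> pv cv; rewrite /divg torus_int_sum; last first.
  by move=> i; case: (cv i) => _ /(_ i)[].
rewrite big1// => i _; apply: torus_int_partial => // x j.
by rewrite /vcoord pv.
Qed.

End Divergence.

(** * Functions of class C^1 and C^2 *)

Section C1Algebra.
Context {R : realType} {d : nat}.
Implicit Types (f g : 'rV[R]_d -> R).

Lemma C1_continuous f : C1 f -> continuous f. Proof. by case. Qed.

Lemma C1_derivable f i x : C1 f -> derivable f x (unit_vec i).
Proof. by case=> _ /(_ i)[]. Qed.

Lemma C1_continuous_partial f i : C1 f -> continuous (partial_d i f).
Proof. by case=> _ /(_ i)[]. Qed.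

Lemma partial_d_cst (c : R) i : partial_d i (fun _ : 'rV[R]_d => c) = fun=> 0.
Proof. by apply/funext => x; exact: derive_cst. Qed.

Lemma partial_dD f g i : C1 f -> C1 g ->
  partial_d i (fun x => f x + g x) = fun x => partial_d i f x + partial_d i g x.
Proof. by move=> cf cg; apply/funext => x; apply: deriveD; exact: C1_derivable. Qed.

Lemma partial_dN f i : C1 f ->
  partial_d i (fun x => - f x) = fun x => - partial_d i f x.
Proof. by move=> cf; apply/funext => x; apply: deriveN; exact: C1_derivable. Qed.

Lemma partial_dB f g i : C1 f -> C1 g ->
  partial_d i (fun x => f x - g x) = fun x => partial_d i f x - partial_d i g x.
Proof. by move=> cf cg; apply/funext => x; apply: deriveB; exact: C1_derivable. Qed.

Lemma partial_dM f g i : C1 f -> C1 g ->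
  partial_d i (fun x => f x * g x) =
  fun x => f x * partial_d i g x + g x * partial_d i f x.
Proof. by move=> cf cg; apply/funext => x; apply: deriveM; exact: C1_derivable. Qed.

Lemma C1_cst (c : R) : C1 (fun _ : 'rV[R]_d => c).
Proof.
split=> [|i]; first exact: continuous_cst.
by split=> [x|]; [exact: derivable_cst | rewrite partial_d_cst; exact: continuous_cst].
Qed.

Lemma C1_add f g : C1 f -> C1 g -> C1 (fun x => f x + g x).
Proof.
move=> cf cg; split=> [|i].
  by apply: continuous_add; exact: C1_continuous.
split=> [x|]; first by apply: derivableD; exact: C1_derivable.
by rewrite partial_dD//; apply: continuous_add; exact: C1_continuous_partial.
Qed.

Lemma C1_opp f : C1 f -> C1 (fun x => - f x).
Proof.
move=> cf; split=> [|i].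
  by apply: continuous_opp; exact: C1_continuous.
split=> [x|]; first by apply: derivableN; exact: C1_derivable.
by rewrite partial_dN//; apply: continuous_opp; exact: C1_continuous_partial.
Qed.

Lemma C1_sub f g : C1 f -> C1 g -> C1 (fun x => f x - g x).
Proof. by move=> cf cg; apply: C1_add => //; exact: C1_opp. Qed.

Lemma C1_mul f g : C1 f -> C1 g -> C1 (fun x => f x * g x).
Proof.
move=> cf cg; split=> [|i].
  by apply: continuous_mul; exact: C1_continuous.
split=> [x|]; first by apply: derivableM; exact: C1_derivable.
rewrite partial_dM//; apply: continuous_add; apply: continuous_mul;
  by [exact: C1_continuous | exact: C1_continuous_partial].
Qed.

Lemma C2_C1 f : C2 f -> C1 f. Proof. by case. Qed.

Lemma C2_partial f i : C2 f -> C1 (partial_d i f). Proof. by case=> _ /(_ i). Qed.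

Lemma C2_cst (c : R) : C2 (fun _ : 'rV[R]_d => c).
Proof. by split=> [|i]; rewrite ?partial_d_cst; exact: C1_cst. Qed.

Lemma C2_add f g : C2 f -> C2 g -> C2 (fun x => f x + g x).
Proof.
move=> [cf ccf] [cg ccg]; split=> [|i]; first exact: C1_add.
by rewrite partial_dD//; exact: C1_add.
Qed.

Lemma C2_sub f g : C2 f -> C2 g -> C2 (fun x => f x - g x).
Proof.
move=> [cf ccf] [cg ccg]; split=> [|i]; first exact: C1_sub.
by rewrite partial_dB//; exact: C1_sub.
Qed.

Lemma C2_scale (c : R) f : C2 f -> C2 (fun x => c * f x).
Proof.
move=> [cf ccf]; split=> [|i]; first by apply: C1_mul => //; exact: C1_cst.
rewrite partial_dM//; last exact: C1_cst.
rewrite partial_d_cst; apply: C1_add; apply: C1_mul => //; exact: C1_cst.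
Qed.

Lemma lapB f g x : C2 f -> C2 g ->
  lap (fun y => f y - g y) x = lap f x - lap g x.
Proof.
move=> cf cg; rewrite /lap -sumrB; apply: eq_bigr => i _.
by rewrite !partial_dB//; [exact: C2_partial..|exact: C2_C1|exact: C2_C1].
Qed.

End C1Algebra.

(** * The comparison principle *)

Section Periodic.
Context {R : realType} {d : nat} {A : Type}.
Implicit Types (f : 'rV[R]_d -> A).

Lemma torus_periodic_int f x i (k : int) : torus_periodic f ->
  f (x + k%:~R *: unit_vec i) = f x.
Proof.
move=> pf.
have pn y (n : nat) : f (y + n%:R *: unit_vec i) = f y.
  elim: n => [|n IH]; first by rewrite scale0r addr0.
  by rewrite -natr1 scalerDl scale1r addrA pf.
case: k => n; first exact: pn.
rewrite NegzE mulrNz scaleNr -[LHS](pn _ n.+1) pmulrn.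
by congr f; rewrite subrK.
Qed.

Lemma torus_periodic_sum f x (k : 'I_d -> int) : torus_periodic f ->
  f (x + \sum_i (k i)%:~R *: unit_vec i) = f x.
Proof.
move=> pf; elim: (index_enum _) => [|i s IH]; first by rewrite big_nil addr0.
by rewrite big_cons addrCA addrC torus_periodic_int.
Qed.

End Periodic.

Section Points.
Context {R : realType} {d : nat}.
Implicit Types (f g : 'rV[R]_d -> R).

(** The corner [l] is free because two cells are needed: the unit cube, and the cell centred at the
    peak of a bump. The point [y] is chosen before [f], so that one representative serves several
    periodic functions at once. *)
Lemma torus_representative (x l : 'rV[R]_d) :
  exists2 y : 'rV[R]_d, (forall i, l ord0 i <= y ord0 i < l ord0 i + 1) &
    forall (A : Type) (f : 'rV[R]_d -> A), torus_periodic f -> f x = f y.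
Proof.
pose k i : int := - Num.floor (x ord0 i - l ord0 i).
exists (x + \sum_i (k i)%:~R *: unit_vec i); last first.
  by move=> A f pf; rewrite torus_periodic_sum.
move=> i; rewrite mxE summxE (bigD1 i)//= big1 => [|j ji]; last first.
  by rewrite !mxE eqxx (negbTE (_ : i != j)) ?mulr0// eq_sym.
rewrite !mxE !eqxx mulr1 addr0 /k mulrNz.
have := floor_le_tmp (x ord0 i - l ord0 i).
have := floorD1_gt (x ord0 i - l ord0 i).
rewrite intrD; lra.
Qed.

Lemma torus_cube_representative (x : 'rV[R]_d) :
  exists2 y, cube d y &
    forall (A : Type) (f : 'rV[R]_d -> A), torus_periodic f -> f x = f y.
Proof.
have [y yl fy] := torus_representative x 0.
exists y => // i; have := yl i; rewrite mxE in_itv/=; lra.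
Qed.

Lemma is_derive_line f (x : 'rV[R]_d) (i : 'I_d) (k : R) :
  derivable f (k *: unit_vec i + x) (unit_vec i) ->
  is_derive k 1 (fun k => f (k *: unit_vec i + x)) (partial_d i f (k *: unit_vec i + x)).
Proof.
move=> df.
apply: (@is_deriv_on_is_derive _ (k - 1) (k + 1)); first by rewrite in_itv/=; lra.
apply: (@is_deriv_on_line _ _ f (fun k => k *: unit_vec i + x)) => // r.
by rewrite addrA -scalerDl subrK.
Qed.

Lemma max_partial0 f (x : 'rV[R]_d) i : C1 f -> (forall y, f y <= f x) ->
  partial_d i f x = 0.
Proof.
move=> [_ /(_ i)[df _]] fx.
have N11 : (-1 : R) <= 1 by lra.
have d0 : is_derive (0:R) 1 (fun k => f (k *: unit_vec i + x)) 0.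
  apply: (@derive1_at_max _ _ (-1) 1) => //.
  - by move=> k _; have [] := is_derive_line (df (k *: unit_vec i + x)).
  - by rewrite in_itv/=; lra.
  - by move=> k _; rewrite scale0r add0r.
have := is_derive_line (df (0 *: unit_vec i + x)).
move=> dE; have := @derive_val _ _ _ _ _ _ _ dE.
by rewrite (@derive_val _ _ _ _ _ _ _ d0) scale0r add0r.
Qed.

(** Were the second partial derivative positive, the first one, which vanishes at [x], would be
    positive just after [x] on the line in direction [i]; the mean value theorem would then make [f]
    exceed its maximum. *)
Lemma max_partial2_le0 f (x : 'rV[R]_d) i : C2 f -> (forall y, f y <= f x) ->
  partial_d i (partial_d i f) x <= 0.
Proof.
move=> [c1f /(_ i) [_ /(_ i)[ddf _]]] fx.
have f0 := max_partial0 i c1f fx.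
case: c1f => _ /(_ i)[df _].
rewrite leNgt; apply/negP => c0.
set c := partial_d i (partial_d i f) x in c0.
have /cvgrPdist_lt/(_ _ c0) := ddf x.
rewrite -/(derive _ _ _) -/(partial_d i _ x) -/c => -[e /= e0 ec].
have [|||xi xi0 E] := @MVT R (fun k => f (k *: unit_vec i + x))
  (fun k => partial_d i f (k *: unit_vec i + x)) 0 (e / 2).
- by rewrite divr_gt0.
- by move=> k _; apply: is_derive_line; exact: df.
- apply: derivable_within_continuous => k _.
  by have [] := is_derive_line (df (k *: unit_vec i + x)).
move: xi0; rewrite in_itv/= => /andP[xi0 xie].
have xin : xi != 0 by rewrite gt_eqF.
have := ec xi; rewrite /ball_/= sub0r normrN f0 subr0 gtr0_norm//.
move=> /(_ _ xin) H.
have {}H : `|c - xi^-1 * partial_d i f (xi *: unit_vec i + x)| < c by apply: H; lra.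
have pos : 0 < partial_d i f (xi *: unit_vec i + x).
  move: H; rewrite ltr_norml => /andP[_ H].
  have : 0 < xi^-1 * partial_d i f (xi *: unit_vec i + x) by lra.
  by rewrite pmulr_rgt0// invr_gt0.
have : f ((e / 2) *: unit_vec i + x) - f (0 *: unit_vec i + x) <= 0.
  by rewrite scale0r add0r subr_le0.
by rewrite E subr0 pmulr_lle0 ?divr_gt0// leNgt pos.
Qed.

End Points.

(** * Calculus of one-sided derivatives in time *)

Section OneSided.
Context {R : realType}.
Implicit Types (a b s : R) (f g : R -> R).

Lemma is_deriv_on_cvg a b g s l : is_deriv_on a b g s l ->
  g r @[r --> within `[a, b] s^'] --> g s.
Proof.
move=> dg.
have h : g s + (r - s) * ((r - s)^-1 * (g r - g s)) @[r --> within `[a, b] s^']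
    --> g s + (s - s) * l.
  apply: cvgD; first exact: cvg_cst.
  apply: cvgM => //; apply: cvgB; last exact: cvg_cst.
  apply: cvg_trans (cvg_within _) _; exact: nbhs_dnbhs.
rewrite subrr mul0r addr0 in h.
apply: cvg_trans h; apply: near_eq_cvg.
exists 1 => //= r _ rs _.
by rewrite mulrA divff ?mul1r ?subr_eq0// addrC subrK.
Qed.

Lemma is_deriv_onD a b f g s k l : is_deriv_on a b f s k ->
  is_deriv_on a b g s l -> is_deriv_on a b (fun s => f s + g s) s (k + l).
Proof.
move=> df dg; apply: (cvg_trans _ (cvgD df dg)); apply: near_eq_cvg; near=> r => /=.
by rewrite -mulrDr opprD addrACA.
Unshelve. all: by end_near. Qed.

Lemma is_deriv_onN a b g s l :
  is_deriv_on a b g s l -> is_deriv_on a b (fun s => - g s) s (- l).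
Proof.
move=> dg; apply: (cvg_trans _ (cvgN dg)); apply: near_eq_cvg; near=> r => /=.
by rewrite -mulrN opprD.
Unshelve. all: by end_near. Qed.

Lemma is_deriv_onM a b f g s k l : is_deriv_on a b f s k ->
  is_deriv_on a b g s l ->
  is_deriv_on a b (fun s => f s * g s) s (k * g s + f s * l).
Proof.
move=> df dg; have cg := is_deriv_on_cvg dg.
apply: (cvg_trans _ (cvgD (cvgM df cg) (cvgM (@cvg_cst _ (f s) _ _ _) dg))).
apply: near_eq_cvg; near=> r => /=.
transitivity ((r - s)^-1 * (f r - f s) * g r + f s * ((r - s)^-1 * (g r - g s))) => //.
ring.
Unshelve. all: by end_near. Qed.

Lemma is_deriv_on_affine a b (c e : R) s : is_deriv_on a b (fun r => c * r + e) s c.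
Proof.
apply: (@cvg_trans _ (cst c @ within `[a, b] s^')); last exact: cvg_cst.
apply: near_eq_cvg; exists 1 => //= r _ rs _.
by rewrite opprD addrACA subrr addr0 -mulrBr mulrCA mulVf ?mulr1// subr_eq0.
Qed.

Lemma is_deriv_on_subset a b a' b' g s l : a <= a' -> b' <= b ->
  is_deriv_on a b g s l -> is_deriv_on a' b' g s l.
Proof.
move=> aa bb; apply: cvg_trans; apply: cvg_app => A /= [e e0 eA].
exists e => //= r sr rs; rewrite in_itv/= => rab; apply: eA => //.
rewrite /= in_itv/=; lra.
Qed.

(** Uniqueness of derivatives rests on this. It fails for [a = b], where the filter contains the
    empty set and every number is a derivative. *)
Lemma within_itv_proper a b s : a < b -> a <= s <= b ->
  ProperFilter (within `[a, b] s^').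
Proof.
move=> ab asb; apply: Build_ProperFilter => -[e /= e0 eA].
have [sb|sb] := ltP s b.
  pose r := Num.min b (s + e / 2).
  have : s < r by rewrite lt_min sb /=; lra.
  have rb : r <= b by rewrite ge_min lexx.
  have re : r <= s + e / 2 by rewrite ge_min lexx orbT.
  move=> sr; apply: (eA r); rewrite /=.
  - by rewrite distrC gtr0_norm; lra.
  - by rewrite gt_eqF.
  - by rewrite in_itv/=; lra.
pose r := Num.max a (s - e / 2).
have : r < s by rewrite gt_max; apply/andP; split; lra.
have rb : a <= r by rewrite le_max lexx.
have re : s - e / 2 <= r by rewrite le_max lexx orbT.
move=> sr; apply: (eA r); rewrite /=.
- by rewrite gtr0_norm; lra.
- by rewrite lt_eqF.
- by rewrite in_itv/=; lra.
Qed.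

Lemma is_deriv_on_unique a b g s k l : a < b -> a <= s <= b ->
  is_deriv_on a b g s k -> is_deriv_on a b g s l -> k = l.
Proof.
move=> ab asb dk dl; have PF := within_itv_proper ab asb.
exact: (cvg_unique _ dk dl).
Qed.

(** Only quotients from the right are used, so the maximum may sit at the initial time [a], but not
    at [b]. *)
Lemma is_deriv_on_max_le0 a b g s l : a <= s < b ->
  (forall r, a <= r <= b -> g r <= g s) -> is_deriv_on a b g s l -> l <= 0.
Proof.
move=> asb gs dg; rewrite leNgt; apply/negP => l0.
have /cvgrPdist_lt/(_ _ l0) [e /= e0 ec] := dg.
pose r := Num.min b (s + e / 2).
have sr : s < r by rewrite lt_min; apply/andP; split; lra.
have rb : r <= b by rewrite ge_min lexx.
have re : r <= s + e / 2 by rewrite ge_min lexx orbT.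
have : `|l - (r - s)^-1 * (g r - g s)| < l.
  apply: ec => /=.
  - by rewrite distrC gtr0_norm; lra.
  - by rewrite gt_eqF.
  - by rewrite in_itv/=; lra.
rewrite ltr_norml => /andP[_]; rewrite ltrBlDr ltrDl.
rewrite pmulr_rgt0 ?invr_gt0 ?subr_gt0// ltNge => /negP; apply.
by apply: gs; lra.
Qed.

End OneSided.

Section Comparison.
Context {R : realType} {d : nat} {V : normedModType R}.
Variables (D T : R) (vel : V -> 'rV[R]_d -> 'rV[R]_d).
Variables (F G : 'rV[R]_d -> V -> R) (q : R -> V) (t : R).
Hypothesis D_ge0 : 0 <= D.

(** Where [phi s - psi s] is maximal in space the two gradients agree, so the quadratic and
    transport terms cancel; only the Laplacians remain, compared thanks to [0 <= D]. The data are
    terminal, so the time derivative is tested from the right. *)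
Lemma hj_le (phi psi : R -> 'rV[R]_d -> R) :
  C12 t T phi -> C12 t T psi ->
  hj_equation D T vel F G q t phi -> hj_equation D T vel F G q t psi ->
  forall s x, t <= s <= T -> phi s x <= psi s x.
Proof.
move=> [phi2 cphi _ _ _] [psi2 cpsi _ _ _] [ephi Tphi] [epsi Tpsi] s0 x0 s0tT.
have tT : t <= T by case/andP: s0tT => /le_trans; apply.
suff main e : 0 < e -> phi s0 x0 - psi s0 x0 <= e * (T - s0).
  rewrite -subr_le0; apply/ler_addgt0Pr => e e0.
  (* The added 1 keeps the denominator positive when [s0 = T]. *)
  have e1 : 0 < e / (T - s0 + 1) by rewrite divr_gt0//; lra.
  apply: le_trans (main _ e1) _; rewrite add0r mulrAC ler_pdivrMr; last lra.
  by rewrite ler_pM2l//; lra.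
move=> e0.
(* At a maximum of [v] before time [T] the equations give a nonnegative
   derivative to [phi - psi], hence at least [e] to [v]: a contradiction. *)
pose v s x := phi s x - psi s x + (e * s + - (e * T)).
have cv : {within `[t, T] `*` cube d, continuous (fun z => v z.1 z.2)}.
  apply: (@continuous_subspaceW _ _ _ [set z : R * 'rV[R]_d | t <= z.1 <= T]).
    by move=> [s x] /= []; rewrite in_itv.
  apply: continuous_add; first exact: continuous_sub.
  apply: continuous_subspaceT; apply: continuous_add; last exact: continuous_cst.
  by apply: continuous_mul; [exact: continuous_cst | move=> z; exact: cvg_fst].
have cK : compact (`[t, T]%classic `*` @cube R d).
  by apply: compact_setX; [exact: segment_compact | exact: compact_cube].
have nK : `[t, T]%classic `*` @cube R d !=set0.
  exists (t, 0) => /=; split; first by rewrite in_itv/= lexx.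
  by move=> i; rewrite mxE in_itv/= lexx ler01.
have [[s x]] := compact_EVT_max nK cK cv.
rewrite inE => -[/=]; rewrite in_itv/= => stT cx vmax.
have pv r : t <= r <= T -> torus_periodic (v r).
  move=> rtT y i; rewrite /v.
  by have [-> _] := phi2 _ rtT; have [-> _] := psi2 _ rtT.
have {}vmax r y : t <= r <= T -> v r y <= v s x.
  move=> rtT; have [z cz fz] := torus_cube_representative y.
  rewrite (fz _ (v r) (pv r rtT)); apply: (vmax (r, z)).
  by rewrite inE /=; split => //; rewrite in_itv.
have [sT|sT] := ltP s T; last first.
  have sE : s = T by lra.
  have := vmax s0 x0 s0tT; rewrite /v sE Tphi Tpsi; lra.
have [[_ c2phi] [_ c2psi]] := (phi2 s stT, psi2 s stT).
pose f y := phi s y - psi s y.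
have c2f : C2 f by exact: C2_sub.
have fmax y : f y <= f x by have := vmax s y stT; rewrite /v lerD2r.
have gradE : grad (phi s) x = grad (psi s) x.
  apply/rowP => i; rewrite !mxE; apply/eqP; rewrite -subr_eq0.
  have := max_partial0 i (C2_C1 c2f) fmax.
  have [c1phi c1psi] := (C2_C1 c2phi, C2_C1 c2psi).
  by rewrite partial_dB// => ->.
have lap_le : lap (phi s) x <= lap (psi s) x.
  rewrite -subr_le0 -lapB//; apply: sumr_le0 => i _; exact: max_partial2_le0.
have [p dp ep] := ephi s x stT; have [p' dp' ep'] := epsi s x stT.
have dv : is_deriv_on t T (v^~ x) s (p + - p' + e).
  apply: is_deriv_onD; last exact: is_deriv_on_affine.
  by apply: is_deriv_onD => //; exact: is_deriv_onN.
have ple : p + - p' + e <= 0.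
  apply: is_deriv_on_max_le0 dv; first by rewrite sT; case/andP: stT => ->.
  by move=> r rtT; exact: vmax.
have : D * lap (phi s) x <= D * lap (psi s) x by rewrite ler_wpM2l.
move: ep ep' ple e0; rewrite gradE; clear.
move: (2^-1 * _) (dotv _ _) (D * lap (phi s) x) (D * lap (psi s) x) (F _ _).
move=> S u l l' c; lra.
Qed.

End Comparison.

(** * Periodic bump functions *)

Section Composition.
Context {R : realType} {d : nat}.
Implicit Types (u : 'rV[R]_d -> R) (g : R -> R).

Lemma is_derive_partial (f : 'rV[R]_d -> R) x i (l : R) :
  is_derive (0 : R) 1 (fun k : R => f (k *: unit_vec i + x)) l ->
  derivable f x (unit_vec i) /\ partial_d i f x = l.
Proof.
move=> [df dl]; rewrite /partial_d.
have E : (fun h => h^-1 *: (((fun k => f (k *: unit_vec i + x)) \o shift 0) (h *: 1)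
    - f (0 *: unit_vec i + x))) =
    (fun h : R => h^-1 *: ((f \o shift x) (h *: unit_vec i) - f x)).
  by apply/funext => h /=; rewrite addr0 [h *: 1]mulr1 scale0r add0r.
by move: df dl; rewrite /derivable /derive E.
Qed.

Lemma partial_d_comp g g' u i x : (forall y : R, is_derive y 1 g (g' y)) -> C1 u ->
  derivable (g \o u) x (unit_vec i) /\
  partial_d i (g \o u) x = g' (u x) * partial_d i u x.
Proof.
move=> dg cu.
have du : is_derive (0 : R) 1 (fun k => u (k *: unit_vec i + x)) (partial_d i u x).
  have cd : derivable u (0 *: unit_vec i + x) (unit_vec i) by exact: C1_derivable.
  have := is_derive_line cd.
  by rewrite scale0r add0r.
apply: is_derive_partial.
rewrite -{1}[u x](_ : u (0 *: unit_vec i + x) = _); last by rewrite scale0r add0r.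
exact: (is_derive1_comp (dg _) du).
Qed.

Lemma C1_comp g g' u : (forall y : R, is_derive y 1 g (g' y)) -> continuous g' ->
  C1 u -> C1 (g \o u).
Proof.
move=> dg cg' cu; have cgu (h : R -> R) : continuous h -> continuous (h \o u).
  by move=> ch x; apply: continuous_comp; [exact: C1_continuous | exact: ch].
split=> [|i].
  apply: cgu => y; apply: differentiable_continuous; apply/derivable1_diffP.
  by case: (dg y).
split=> [x|]; first by have [] := partial_d_comp i x dg cu.
rewrite (_ : partial_d i _ = fun x => g' (u x) * partial_d i u x).
  by apply: continuous_mul; [exact: cgu | exact: C1_continuous_partial].
by apply/funext => x; have [] := partial_d_comp i x dg cu.
Qed.

Lemma C2_comp g g' g'' u : (forall y : R, is_derive y 1 g (g' y)) ->
  (forall y : R, is_derive y 1 g' (g'' y)) -> continuous g'' ->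
  C2 u -> C2 (g \o u).
Proof.
move=> dg dg' cg'' cu; have c1u := C2_C1 cu.
have cg' : continuous g'.
  by move=> y; apply: differentiable_continuous; apply/derivable1_diffP; case: (dg' y).
split=> [|i]; first exact: C1_comp dg cg' c1u.
rewrite (_ : partial_d i _ = fun x => (g' \o u) x * partial_d i u x).
  by apply: C1_mul; [exact: C1_comp dg' cg'' c1u | exact: C2_partial].
by apply/funext => x; have [] := partial_d_comp i x dg c1u.
Qed.

Lemma C2_sum (I : finType) (f : I -> 'rV[R]_d -> R) :
  (forall i, C2 (f i)) -> C2 (fun x => \sum_i f i x).
Proof.
move=> cf; elim: (index_enum I) => [|i s IH].
  by under eq_fun do rewrite big_nil; exact: C2_cst.
under eq_fun do rewrite big_cons.
exact: (@C2_add _ _ (f i) (fun x => \sum_(j <- s) f j x) (cf i) IH).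
Qed.

Lemma C2_coord (i : 'I_d) : C2 (fun x : 'rV[R]_d => x ord0 i).
Proof.
have H x j : derivable (fun x : 'rV[R]_d => x ord0 i) x (unit_vec j) /\
    partial_d j (fun x : 'rV[R]_d => x ord0 i) x = (j == i)%:R.
  apply: is_derive_partial.
  have -> : (fun k : R => (k *: unit_vec j + x) ord0 i) =
      (fun k => (j == i)%:R * k + x ord0 i).
    by apply/funext => k; rewrite !mxE eqxx /= eq_sym mulrC.
  apply: is_derive_eq; rewrite !(mulr0, addr0, mulr1, scaler0) //.
  by rewrite [LHS]mulr1.
have pE j : partial_d j (fun x : 'rV[R]_d => x ord0 i) = fun=> (j == i)%:R.
  by apply/funext => x; have [] := H x j.
split=> [|j]; last by rewrite pE; exact: C1_cst.
split=> [|j]; first exact: coord_continuous.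
split=> [x|]; first by have [] := H x j.
by rewrite pE; exact: continuous_cst.
Qed.

End Composition.

Section Bump.
Context {R : realType}.

(* The cube of the positive part is of class C^2, which makes [bump] below a
   nonnegative C^2 function vanishing outside a small neighbourhood of [a]
   modulo Z^d. *)
Definition ppart (u : R) : R := Num.max 0 u.

(** A quadratic bound on the Taylor remainder replaces limits at the corner of the positive part:
    only polynomial inequalities are left, according to the signs of [x] and [y]. *)
Lemma is_derive_quadratic (g : R -> R) x l C :
  (forall y, `|y - x| <= 1 -> `|g y - g x - l * (y - x)| <= C * (y - x) ^+ 2) ->
  is_derive x 1 g l.
Proof.
move=> gC.
apply: (@is_deriv_on_is_derive _ (x - 1) (x + 1)); first by rewrite in_itv/=; lra.
apply/cvgrPdist_lt => e e0 /=.
pose K := `|C| + 1; have K0 : 0 < K by rewrite /K ltr_pwDr.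
exists (Num.min 1 (e / K)); first by rewrite /= lt_min ltr01 divr_gt0.
move=> y /=; rewrite lt_min distrC => /andP[y1 yK] yx _.
have yx0 : y - x != 0 by rewrite subr_eq0.
have -> : l - (y - x)^-1 * (g y - g x) = - ((y - x)^-1 * (g y - g x - l * (y - x))).
  by field.
rewrite normrN normrM normfV -ltr_pdivlMl ?invr_gt0 ?normr_gt0// invrK.
apply: le_lt_trans (gC _ (ltW y1)) _.
rewrite -[(y - x) ^+ 2]real_normK ?num_real//.
move: yK; rewrite ltr_pdivlMr// /K; have : 0 < `|y - x| by rewrite normr_gt0.
set t := `|y - x| => t0 tK.
have h1 : 0 < t * (e - t * (`|C| + 1)) by rewrite mulr_gt0// subr_gt0.
have h2 : 0 <= t ^+ 2 * (`|C| - C) by rewrite mulr_ge0 ?sqr_ge0// subr_ge0 ler_norm.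
have h3 := sqr_ge0 t; nra.
Qed.

Lemma is_derive_ppart3 (x : R) :
  is_derive x 1 (fun u => ppart u ^+ 3) (3 * ppart x ^+ 2).
Proof.
(* For nonnegative [x] and [y] the remainder is [(y - x)^2 * (3 * x + (y - x))], with
   [|y - x| <= 1]. *)
apply: (@is_derive_quadratic _ _ _ (3 * ppart x + 1)) => y; rewrite /ppart !ler_norml.
have t2 : 0 <= (y - x) ^+ 2 := sqr_ge0 _.
case: (leP 0 x) => x0; case: (leP 0 y) => y0 /andP[h1 h2]; last by rewrite !expr0n/=; lra.
- have k1 : 0 <= (y - x) ^+ 2 * (1 - (y - x)) by rewrite mulr_ge0// subr_ge0.
  have k2 : 0 <= (y - x) ^+ 2 * (1 + (y - x)) by rewrite mulr_ge0//; lra.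
  have k3 : 0 <= (y - x) ^+ 2 * x by rewrite mulr_ge0.
  by apply/andP; split; nra.
- have k1 : 0 <= x ^+ 2 * x by rewrite mulr_ge0// sqr_ge0.
  have k2 : 0 <= x ^+ 2 * - y by rewrite mulr_ge0// ?sqr_ge0//; lra.
  have k3 : 0 <= x * y ^+ 2 by rewrite mulr_ge0// sqr_ge0.
  by apply/andP; split; nra.
- have k1 : 0 <= y ^+ 2 * (1 - y) by rewrite mulr_ge0// ?sqr_ge0//; lra.
  have k2 : 0 <= y ^+ 2 * y by rewrite mulr_ge0// ?sqr_ge0.
  have k3 : 0 <= - x * (y - x + y) by rewrite mulr_ge0//; lra.
  by apply/andP; split; nra.
Qed.

Lemma is_derive_ppart2 (x : R) :
  is_derive x 1 (fun u => 3 * ppart u ^+ 2) (6 * ppart x).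
Proof.
(* For nonnegative [x] and [y] the remainder is exactly [3 * (y - x)^2]. *)
apply: (@is_derive_quadratic _ _ _ 3) => y; rewrite /ppart !ler_norml.
have t2 : 0 <= (y - x) ^+ 2 := sqr_ge0 _.
have x2 : 0 <= x ^+ 2 := sqr_ge0 _; have y2 : 0 <= y ^+ 2 := sqr_ge0 _.
case: (leP 0 x) => x0; case: (leP 0 y) => y0 _; last by rewrite !expr0n/=; lra.
- by apply/andP; split; nra.
- have k : 0 <= x * - y by rewrite mulr_ge0//; lra.
  by apply/andP; split; nra.
- have k : 0 <= - x * (y - x + y) by rewrite mulr_ge0//; lra.
  by apply/andP; split; nra.
Qed.

Lemma continuous_ppart : continuous (fun u : R => 6 * ppart u).
Proof.
apply: continuous_mul; first exact: continuous_cst.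
by move=> x; apply: continuous_max; [exact: cst_continuous | exact: cvg_id].
Qed.

Lemma pi2_gt0 : 0 < pi *+ 2 :> R.
Proof. by rewrite pmulrn_lgt0// pi_gt0. Qed.

Lemma pi2_itv (v : R) : 0 <= v <= 1 / 2 -> pi *+ 2 * v \in `[0, pi].
Proof.
have pi0 := @pi_gt0 R.
move=> /andP[v0 v2]; rewrite in_itv/= mulr_ge0 ?(ltW pi2_gt0)//=.
have : 0 <= pi * (1 / 2 - v) by rewrite mulr_ge0 ?subr_ge0// ltW.
rewrite mulr2n; nra.
Qed.

Section FixedDimension.
Context {d : nat}.
Implicit Types (a x : 'rV[R]_d).

(** The sum of cosines is at most [d], with equality exactly when [x] equals [a] modulo Z^d, so
    [kappa] sets the width of the bump; periodicity comes from the cosines, without summing over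
    translates. *)
Definition bump a (kappa : R) x : R :=
  ppart (\sum_i cos (pi *+ 2 * (x ord0 i - a ord0 i)) - (d%:R - kappa)) ^+ 3.

Lemma density_bump a kappa : density (bump a kappa).
Proof.
split=> [x i||x].
- rewrite /bump; congr (ppart (_ - _) ^+ 3); apply: eq_bigr => j _.
  rewrite !mxE eqxx /=; case: (j == i); last by rewrite addr0.
  by rewrite addrAC mulrDr mulr1 cosD2pi.
- apply: (@C2_comp _ _ (fun u => ppart u ^+ 3) (fun u => 3 * ppart u ^+ 2)
    (fun u => 6 * ppart u)
    (fun x => \sum_i cos (pi *+ 2 * (x ord0 i - a ord0 i)) - (d%:R - kappa))).
  + exact: is_derive_ppart3.
  + exact: is_derive_ppart2.
  + exact: continuous_ppart.
  apply: C2_sub; last exact: C2_cst.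
  apply: C2_sum => i.
  apply: (@C2_comp _ _ cos (fun u => - sin u) (fun u => - cos u)
    (fun x => pi *+ 2 * (x ord0 i - a ord0 i))).
  + by apply: continuous_opp; exact: continuous_cos.
  by apply: C2_scale; apply: C2_sub; [exact: C2_coord | exact: C2_cst].
- by rewrite exprn_ge0// /ppart le_max lexx.
Qed.

Lemma bump_gt0 a kappa x : 0 < bump a kappa x ->
  forall i, 1 - kappa < cos (pi *+ 2 * (x ord0 i - a ord0 i)).
Proof.
rewrite /bump /ppart => b0 i.
have S0 : 0 < \sum_i cos (pi *+ 2 * (x ord0 i - a ord0 i)) - (d%:R - kappa).
  by rewrite ltNge; apply/negP => S0; move: b0; rewrite max_l// expr0n ltxx.
have : \sum_(j | j != i) cos (pi *+ 2 * (x ord0 j - a ord0 j))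
    <= \sum_(j | j != i) (1 : R).
  by apply: ler_sum => j _; exact: cos_le1.
have : (d%:R : R) = 1 + \sum_(j | j != i) (1 : R).
  have := sumr_const 'I_d (1 : R); rewrite card_ord => <-.
  by rewrite (bigD1 i).
move: S0; rewrite (bigD1 i)//=; lra.
Qed.

(** With [kappa = 1 - cos (2 pi delta)], positivity of the bump makes each cosine larger than
    [cos (2 pi delta)]. In the cell centred at [a] the angles have absolute value at most [pi],
    where the cosine decreases, so the inequality passes to the arguments. *)
Lemma bump_local a (delta : R) x : 0 < delta <= 1 / 2 ->
  (forall i, a ord0 i + - (1 / 2) <= x ord0 i < a ord0 i + - (1 / 2) + 1) ->
  0 < bump a (1 - cos (pi *+ 2 * delta)) x ->
  forall i, `|x ord0 i - a ord0 i| < delta.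
Proof.
move=> dl xa /bump_gt0 b i; have := b i; have := xa i.
set u := x ord0 i - a ord0 i => xai.
rewrite subKr -[cos (_ * u)]cos_norm normrM (gtr0_norm pi2_gt0).
have u1 : `|u| <= 1 / 2 by rewrite ler_norml /u; lra.
have u0 := normr_ge0 u.
by rewrite ltr_cos ?pi2_itv ?(ltr_pM2l pi2_gt0)//; lra.
Qed.

Lemma bump_center_gt0 a (delta : R) : 0 < delta <= 1 / 2 ->
  0 < bump a (1 - cos (pi *+ 2 * delta)) a.
Proof.
move=> dl; rewrite exprn_gt0// /ppart lt_max; apply/orP; right.
rewrite (eq_bigr (fun=> 1)) => [|i _]; last by rewrite subrr mulr0 cos0.
rewrite sumr_const card_ord.
have : cos (pi *+ 2 * delta) < cos 0.
  rewrite ltr_cos; first by rewrite mulr_gt0 ?pi2_gt0//; lra.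
    by rewrite in_itv/= lexx ltW// pi_gt0.
  by apply: pi2_itv; lra.
rewrite cos0; lra.
Qed.

(** If the function were positive at some point, a bump supported where it is positive would have a
    positive integral against it; applying this to [- h] as well excludes both signs. *)
Lemma torus_int_density_eq0 (h : 'rV[R]_d -> R) : continuous h -> torus_periodic h ->
  (forall eta, density eta -> torus_int (fun x => h x * eta x) = 0) ->
  forall x, h x = 0.
Proof.
move=> ch ph h0 x; apply/eqP; rewrite eq_le; apply/andP.
suff main (g : 'rV[R]_d -> R) : continuous g -> torus_periodic g ->
    (forall eta, density eta -> torus_int (fun x => g x * eta x) = 0) ->
    g x <= 0.
  split; first exact: main.
  rewrite -oppr_le0; apply: (main (fun x => - h x)).
  - exact: continuous_opp.
  - by move=> y i; rewrite ph.
  move=> eta deta; have ceta : continuous eta.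
    by case: deta => _ [[]].
  rewrite -[RHS]oppr0 -(h0 _ deta) -torus_intN; last exact: continuous_mul.
  by congr torus_int; apply/funext => y; rewrite mulNr.
move=> cg pg g0; rewrite leNgt; apply/negP => gx0.
have [a ca xa] := torus_cube_representative x.
have ga0 : 0 < g a by rewrite -(xa _ g pg).
have /cvgrPdist_lt/(_ _ ga0) := cg a; rewrite -/(_ --> _) => ga.
have [e e0 eg] : exists2 e, 0 < e & forall y, `|a - y| < e -> 0 < g y.
  move: ga => /nbhs_ballP [e /= e0 eg]; exists e => // y ay.
  have := eg y; rewrite -ball_normE => /(_ ay) /=.
  by rewrite ltr_norml => /andP[_]; rewrite ltrBlDr ltrDl.
pose delta := Num.min (1 / 2) e.
have dl : 0 < delta <= 1 / 2.
  by rewrite lt_min e0 ge_min lexx /= !andbT; lra.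
pose eta := bump a (1 - cos (pi *+ 2 * delta)).
have deta : density eta by exact: density_bump.
have ceta : continuous eta by case: deta => _ [[]].
have : 0 < torus_int (fun y => g y * eta y).
  apply: (@torus_int_gt0 _ _ _ a) => //; first exact: continuous_mul.
  - move=> y _.
    (* The point [y] ranges over the unit cube, where the bump may reappear near other faces; its
       representative in the cell centred at [a] is the one to which [bump_local] applies. *)
    have [z za yz] := torus_representative y (\row_i (a ord0 i - 1 / 2)).
    have [peta _ eta_ge0] := deta.
    rewrite (yz _ g pg) (yz _ eta peta).
    have := eta_ge0 z; rewrite le_eqVlt => /predU1P[<-|etaz]; first by rewrite mulr0.
    apply/ltW/mulr_gt0 => //; apply: eg.
    rewrite [ltLHS]mx_normrE; apply/bigmax_ltP; split => // -[k i] _ /=.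
    rewrite (ord1 k) !mxE distrC.
    have : `|z ord0 i - a ord0 i| < delta.
      by apply: (bump_local dl _ etaz) => j; have := za j; rewrite mxE.
    by rewrite lt_min => /andP[].
  - by rewrite mulr_gt0// bump_center_gt0.
by rewrite g0// ltxx.
Qed.

End FixedDimension.
End Bump.

(** * The value function *)

Section FirstVariationTheory.
Context {R : realType} {d : nat}.
Implicit Types (rho : 'rV[R]_d -> R) (J : ('rV[R]_d -> R) -> R).

Lemma density_continuous rho : density rho -> continuous rho.
Proof. by case=> _ [[]]. Qed.

Lemma density_comb (a b : R) rho rho' : 0 <= a -> 0 <= b ->
  density rho -> density rho' -> density (fun x => a * rho x + b * rho' x).
Proof.
move=> a0 b0 [prho c2rho rho0] [prho' c2rho' rho'0]; split=> [x i||x].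
- by rewrite prho prho'.
- by apply: C2_add; exact: C2_scale.
- by rewrite addr_ge0// mulr_ge0.
Qed.

(** The formula for [J] is known on densities only, and the perturbed function is a convex
    combination of densities for [0 < e <= 1]; there the quotient does not depend on [e]. *)
Lemma linear_first_variation J (g : 'rV[R]_d -> R) rho :
  continuous g -> torus_periodic g -> density rho ->
  (forall m, density m -> J m = torus_int (fun x => g x * m x)) ->
  is_first_variation J rho g.
Proof.
move=> cg pg drho JE; split=> // rho' drho'.
have crho := density_continuous drho; have crho' := density_continuous drho'.
apply: cvg_near_cst; near=> e.
have e0 : 0 < e by near: e; exact: nbhs_right_gt.
have e1 : e <= 1 by near: e; apply: nbhs_right_le; exact: ltr01.
have mixE : (fun x => rho x + e * (rho' x - rho x)) =
    (fun x => (1 - e) * rho x + e * rho' x) by apply/funext => x; ring.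
rewrite (JE rho)// JE; last by rewrite mixE; apply: density_comb => //; lra.
have cd : continuous (fun x => g x * (rho' x - rho x)).
  by apply: continuous_mul => //; exact: continuous_sub.
rewrite (_ : (fun x => g x * (rho x + e * (rho' x - rho x))) =
  (fun x => g x * rho x + e * (g x * (rho' x - rho x)))); last by apply/funext => x; ring.
rewrite torus_intD ?torus_intZ//; first by rewrite addrAC subrr add0r mulKf// gt_eqF.
  exact: continuous_mul.
by apply: continuous_mul => //; exact: continuous_cst.
Unshelve. all: by end_near. Qed.

(** Since masses are free, [rho + eta] is a density for every density [eta]. Every [eta] is thus an
    admissible direction, and [g - g'] integrates to 0 against all of them. *)
Lemma is_first_variation_unique J rho (g g' : 'rV[R]_d -> R) : density rho ->
  is_first_variation J rho g -> is_first_variation J rho g' -> g = g'.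
Proof.
move=> drho [pg cg Jg] [pg' cg' Jg']; apply/funext => x; apply/eqP.
rewrite -subr_eq0; apply/eqP.
apply: (@torus_int_density_eq0 _ _ (fun x => g x - g' x)); first exact: continuous_sub.
  by move=> y i; rewrite pg pg'.
move=> eta deta; have ceta := density_continuous deta.
have drho' : density (fun x => rho x + eta x).
  have := density_comb ler01 ler01 drho deta.
  by under eq_fun do rewrite !mul1r.
have E k : (fun x => k x * (rho x + eta x - rho x)) = (fun x => k x * eta x).
  by apply/funext => y; rewrite addrAC subrr add0r.
have := cvg_unique _ (Jg _ drho') (Jg' _ drho'); rewrite !E => gg'.
under eq_fun do rewrite mulrBl.
by rewrite torus_intB ?gg' ?subrr//; exact: continuous_mul.
Qed.

Lemma first_variationE J rho g : density rho ->
  is_first_variation J rho g -> first_variation J rho = g.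
Proof.
move=> drho Jg; apply: (is_first_variation_unique drho _ Jg).
by apply: (@xgetPex _ _ [set g | is_first_variation J rho g]); exists g.
Qed.

End FirstVariationTheory.

Section MFG.
Context {R : realType} {d : nat} {V : normedModType R}.
Variables (D T : R) (vel : V -> 'rV[R]_d -> 'rV[R]_d).
Variables (F G : 'rV[R]_d -> V -> R) (q : R -> V).
Hypothesis vel_per : forall w, torus_periodic (vel w).
Hypothesis vel_C1 : forall w i, C1 (vcoord (vel w) i).

Lemma value_minimizer t rho r alpha :
  is_minimizer D T vel F G q t rho r alpha ->
  value D T vel F G q rho t = cost T F G q t r alpha.
Proof.
move=> [adm mini]; rewrite /value.
set S := [set c | _].
have Sc : S (cost T F G q t r alpha) by exists r, alpha.
have lbS : lbound S (cost T F G q t r alpha).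
  by move=> _ [r' [alpha' [adm' ->]]]; exact: mini.
apply/eqP; rewrite eq_le; apply/andP; split.
  by apply: ge_inf => //; exists (cost T F G q t r alpha).
by apply: lb_le_inf => //; exists (cost T F G q t r alpha).
Qed.

Lemma cost_terminal r alpha :
  cost T F G q T r alpha = torus_int (fun x => G x (q T) * r T x).
Proof. by rewrite /cost set_itv1 Rintegral_set1 addr0. Qed.

Lemma C12_subset t s (f : R -> 'rV[R]_d -> R) : t <= s -> C12 t T f -> C12 s T f.
Proof.
move=> ts; have sub : [set z : R * 'rV[R]_d | s <= z.1 <= T] `<=` [set z | t <= z.1 <= T].
  by move=> z /= /andP[sz ->]; rewrite (le_trans ts sz).
have jc (h : R -> 'rV[R]_d -> R) : jointly_continuous t T h -> jointly_continuous s T h.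
  exact: continuous_subspaceW.
move=> [c2f cf cdf cddf [ft cft dft]]; split.
- by move=> r srT; apply: c2f; lra.
- exact: jc.
- by move=> i; exact: jc.
- by move=> i j; exact: jc.
- exists ft; first exact: jc.
  move=> r x srT; apply: (@is_deriv_on_subset _ t T) => //; apply: dft; lra.
Qed.

Lemma hj_equation_subset t s phi : t <= s ->
  hj_equation D T vel F G q t phi -> hj_equation D T vel F G q s phi.
Proof.
move=> ts [hj hjT]; split=> // r x srT.
have [|p dp pE] := hj r x; first lra.
by exists p => //; exact: (@is_deriv_on_subset _ t T).
Qed.

Lemma hj_unique t phi psi : 0 <= D ->
  C12 t T phi -> C12 t T psi ->
  hj_equation D T vel F G q t phi -> hj_equation D T vel F G q t psi ->
  forall s x, t <= s <= T -> phi s x = psi s x.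
Proof.
move=> D0 cphi cpsi hphi hpsi s x stT; apply/eqP; rewrite eq_le.
by rewrite (hj_le D0 cphi cpsi hphi hpsi)// (hj_le D0 cpsi cphi hpsi hphi).
Qed.

(** * Pairing of the two equations of the MFG-1 system *)

Section Duality.
Variables (r phi : 'rV[R]_d -> R) (w : V).
Hypothesis C2r : C2 r.
Hypothesis C2phi : C2 phi.
Hypothesis per_r : torus_periodic r.
Hypothesis per_phi : torus_periodic phi.

(* The flux whose divergence collects the integrations by parts in the
   derivative of the pairing of [phi] and [r]. *)
Definition pairing_flux (x : 'rV[R]_d) : 'rV[R]_d :=
  \row_i (phi x * (r x * (vcoord (vel w) i x + partial_d i phi x))
          + D * (r x * partial_d i phi x - phi x * partial_d i r x)).

Lemma C1_velocity i : C1 (fun x => r x * (vcoord (vel w) i x + partial_d i phi x)).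
Proof. exact: (C1_mul (C2_C1 C2r) (C1_add (vel_C1 w i) (C2_partial i C2phi))). Qed.

Lemma partial_d_periodic (f : 'rV[R]_d -> R) i :
  torus_periodic f -> torus_periodic (partial_d i f).
Proof.
move=> pf x j; rewrite /partial_d /derive.
have -> // : (fun h : R => h^-1 *: ((f \o shift (x + unit_vec j)) (h *: unit_vec i)
    - f (x + unit_vec j))) =
  (fun h => h^-1 *: ((f \o shift x) (h *: unit_vec i) - f x)).
by apply/funext => h /=; rewrite addrA !pf.
Qed.

Lemma vcoord_pairing_flux i : vcoord pairing_flux i = fun x =>
  phi x * (r x * (vcoord (vel w) i x + partial_d i phi x))
  + D * (r x * partial_d i phi x - phi x * partial_d i r x).
Proof. by apply/funext => x; rewrite /vcoord mxE. Qed.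

Lemma C1_diffusion i :
  C1 (fun x => r x * partial_d i phi x - phi x * partial_d i r x).
Proof.
exact: (C1_sub (C1_mul (C2_C1 C2r) (C2_partial i C2phi))
  (C1_mul (C2_C1 C2phi) (C2_partial i C2r))).
Qed.

Lemma C1_pairing_flux i : C1 (vcoord pairing_flux i).
Proof.
rewrite vcoord_pairing_flux.
exact: (C1_add (C1_mul (C2_C1 C2phi) (C1_velocity i))
  (C1_mul (C1_cst D) (C1_diffusion i))).
Qed.

Lemma periodic_pairing_flux : torus_periodic pairing_flux.
Proof.
move=> x i; apply/rowP => j; rewrite !mxE per_phi per_r /vcoord vel_per.
by rewrite !partial_d_periodic.
Qed.

(** The drift part is the product rule for [phi] times the Fokker-Planck flux; the diffusion part is
    Green's second identity. *)
Lemma divg_pairing_flux x : divg pairing_flux x =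
  phi x * divg (fun y => r y *: (vel w y + grad phi y)) x
  + r x * (dotv (grad phi x) (vel w x) + sqnorm (grad phi x))
  + D * (r x * lap phi x - phi x * lap r x).
Proof.
rewrite /divg /lap /sqnorm /dotv -!big_split/= !mulr_sumr -sumrB mulr_sumr.
rewrite -!big_split/=; apply: eq_bigr => i _.
have -> : vcoord (fun y => r y *: (vel w y + grad phi y)) i =
    (fun x => r x * (vcoord (vel w) i x + partial_d i phi x)).
  by apply/funext => y; rewrite /vcoord !mxE.
have c1r := C2_C1 C2r; have c1phi := C2_C1 C2phi.
have [c1pr c1pphi] := (C2_partial i C2r, C2_partial i C2phi).
rewrite vcoord_pairing_flux.
rewrite (partial_dD _ (C1_mul c1phi (C1_velocity i))
  (C1_mul (C1_cst D) (C1_diffusion i))).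
rewrite (partial_dM _ c1phi (C1_velocity i)).
rewrite (partial_dM _ (C1_cst D) (C1_diffusion i)) partial_d_cst.
rewrite (partial_dB _ (C1_mul c1r c1pphi) (C1_mul c1phi c1pr)).
rewrite (partial_dM _ c1r c1pphi) (partial_dM _ c1phi c1pr) !mxE /vcoord.
move: (partial_d i (fun _ => _) x) (partial_d i (partial_d i phi) x)
  (partial_d i (partial_d i r) x) (partial_d i phi x) (partial_d i r x)
  (vel w x 0 i) (phi x) (r x) => dv pp rr p p' u f g.
by ring.
Qed.

End Duality.

(** The running cost integrates to the increment of the pairing of [phi] and [r] from [t] to [T].
    Its value at [T] cancels the terminal cost, because [phi T] is [- G]. *)
Lemma mfg1_cost t rho r phi : t <= T ->
  mfg1_solution D T vel F G q t rho r phi ->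
  cost T F G q t r (fun s => grad (phi s)) = - torus_int (fun x => phi t x * rho x).
Proof.
move=> tT [C12r C12phi [fp rt] [hj hjT]].
have cphir s : t <= s <= T -> continuous (fun x => phi s x * r s x).
  case: C12r C12phi => c2r _ _ _ _ [c2phi _ _ _ _] stT.
  by apply: continuous_mul; apply: C1_continuous; apply: C2_C1;
    [case: (c2phi s stT) | case: (c2r s stT)].
have TT : t <= T <= T by rewrite tT lexx.
have GT : torus_int (fun x => G x (q T) * r T x) = - torus_int (fun x => phi T x * r T x).
  rewrite -torus_intN; last exact: cphir.
  by congr torus_int; apply/funext => x; rewrite hjT mulNr opprK.
(* At [t = T] the equations carry no information on time derivatives, but the cost is then purely
   terminal. *)
move: tT; rewrite le_eqVlt => /predU1P[tE|tT].
  by subst t; rewrite cost_terminal GT rt.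
case: (C12r) => c2r cr _ _ [dr cdr drE].
case: (C12phi) => c2phi cphi _ _ [dphi cdphi dphiE].
pose h s x := phi s x * r s x.
pose h' s x := dphi s x * r s x + phi s x * dr s x.
have ch : jointly_continuous t T h by exact: continuous_mul.
have ch' : jointly_continuous t T h'.
  by apply: continuous_add; exact: continuous_mul.
have dh s x : t <= s <= T -> is_deriv_on t T (h^~ x) s (h' s x).
  by move=> stT; apply: is_deriv_onM; [exact: dphiE | exact: drE].
have hE s : t <= s <= T -> torus_int (fun x =>
    (2^-1 * sqnorm (grad (phi s) x) + F x (q s)) * r s x) = torus_int (h' s).
  move=> stT; have [[pr c2rs] [pphi c2phis]] := (c2r s stT, c2phi s stT).
  pose W := pairing_flux (r s) (phi s) (q s).
  have cW i : C1 (vcoord W i) by exact: C1_pairing_flux.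
  (* Adding the vanishing integral of a divergence turns the equality of integrals into a pointwise
     identity. *)
  rewrite -[RHS]addr0 -(@torus_int_divg _ _ W)//; last exact: periodic_pairing_flux.
  rewrite -torus_intD; first last.
  - by apply: continuous_sum => i; apply: C1_continuous_partial.
  - exact: jointly_continuous_slice stT ch'.
  congr torus_int; apply/funext => x; rewrite divg_pairing_flux//.
  have [rs drs rsE] := fp s x stT; have [ps dps psE] := hj s x stT.
  (* The equations only assert that some derivative exists; uniqueness identifies it with the
     jointly continuous one from [C12]. *)
  have rsE' := is_deriv_on_unique tT stT drs (drE s x stT).
  have psE' := is_deriv_on_unique tT stT dps (dphiE s x stT).
  rewrite /h' -rsE' -psE' -psE; set dv := divg _ _ in rsE *.
  have -> : rs = D * lap (r s) x - dv by rewrite -rsE addrK.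
  clear; move: dv (sqnorm _) (dotv _ _) (lap (r s) x) (lap (phi s) x) (r s x) (phi s x).
  by move=> dv S u lr lphi rx phix; field.
rewrite /cost GT.
have -> : \int[lebesgue_measure]_(s in `[t, T]) torus_int (fun x =>
      (2^-1 * sqnorm (grad (phi s) x) + F x (q s)) * r s x) =
    \int[lebesgue_measure]_(s in `[t, T]) torus_int (h' s).
  by apply: eq_Rintegral => s; rewrite inE /= in_itv/= => stT; exact: hE.
by rewrite (Rintegral_torus_int tT ch ch' dh) addrA addNr add0r /h rt.
Qed.


Section ValueFunction.
Variable t0 : R.
Hypothesis D_ge0 : 0 <= D.
Hypothesis minimizer_is_solution : forall rho t, density rho -> t0 <= t <= T ->
  exists r phi : R -> 'rV[R]_d -> R,
    mfg1_solution D T vel F G q t rho r phi /\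
    is_minimizer D T vel F G q t rho r (fun s => grad (phi s)).

(** The minimizer for [rho] comes with its own [psi]; uniqueness replaces it by the given [phi],
    which is chosen independently of [rho]. *)
Lemma value_pairing s phi rho : t0 <= s <= T -> density rho ->
  C12 s T phi -> hj_equation D T vel F G q s phi ->
  value D T vel F G q rho s = torus_int (fun x => - phi s x * rho x).
Proof.
move=> sT drho cphi hphi.
have [r [psi [sol mini]]] := minimizer_is_solution drho sT.
have [_ cpsi _ hpsi] := sol.
have sT' : s <= s <= T by rewrite lexx; case/andP: sT => _ ->.
rewrite (value_minimizer mini) (mfg1_cost _ sol); last by case/andP: sT.
have [_ c2phis] : torus_periodic (phi s) /\ C2 (phi s) by case: cphi => + _ _ _ _; apply.
rewrite -torus_intN.
  congr torus_int; apply/funext => x.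
  by rewrite mulNr (hj_unique D_ge0 cpsi cphi hpsi hphi).
apply: continuous_mul; last exact: density_continuous.
have -> : psi s = phi s.
  by apply/funext => x; exact: (hj_unique D_ge0 cpsi cphi hpsi hphi).
exact: C1_continuous (C2_C1 c2phis).
Qed.

Lemma value_first_variation s phi rho : t0 <= s <= T -> density rho ->
  C12 s T phi -> hj_equation D T vel F G q s phi ->
  is_first_variation (fun m => value D T vel F G q m s) rho (fun x => - phi s x).
Proof.
move=> sT drho cphi hphi.
have [pphi c2phi] : torus_periodic (phi s) /\ C2 (phi s).
  by case: cphi => + _ _ _ _; apply; rewrite lexx; case/andP: sT.
apply: linear_first_variation => //.
- by apply: continuous_opp; exact: C1_continuous (C2_C1 c2phi).
- by move=> x i; rewrite pphi.
- by move=> m dm; exact: value_pairing.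
Qed.

Lemma value_terminal rho : t0 <= T -> density rho ->
  value D T vel F G q rho T = torus_int (fun x => G x (q T) * rho x).
Proof.
move=> t0T drho; have t0TT : t0 <= T <= T by rewrite t0T lexx.
have [r [psi [[_ _ [_ rT] _] mini]]] := minimizer_is_solution drho t0TT.
by rewrite (value_minimizer mini) cost_terminal rT.
Qed.

(** On all of [[t0, T]] the value is the pairing of [rho] with restrictions of the same [phi], so
    only [- phi] is differentiated in time, and the Hamilton-Jacobi equation turns the result into
    the integrand of the Hamiltonian. *)
Lemma value_time_derivative phi rho t : t0 < T -> t0 <= t <= T -> density rho ->
  C12 t0 T phi -> hj_equation D T vel F G q t0 phi ->
  is_deriv_on t0 T (fun s => value D T vel F G q rho s) t
    (hamiltonian1 D vel F rho (phi t) (q t)).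
Proof.
move=> t0T t0tT drho cphi hphi.
have [c2phi jphi _ _ [dphi jdphi dphiE]] := cphi.
have jrho : jointly_continuous t0 T (fun _ : R => rho).
  apply: continuous_subspaceT => z.
  by apply: (@cvg_comp _ _ _ snd rho); [exact: cvg_snd | exact: density_continuous].
pose h s x := - phi s x * rho x.
pose h' s x := - dphi s x * rho x.
have ch : jointly_continuous t0 T h.
  by apply: continuous_mul => //; exact: continuous_opp.
have ch' : jointly_continuous t0 T h'.
  by apply: continuous_mul => //; exact: continuous_opp.
have dh s x : t0 <= s <= T -> is_deriv_on t0 T (h^~ x) s (h' s x).
  move=> sT; rewrite /h' -[X in is_deriv_on _ _ _ _ X]addr0.
  rewrite -[X in _ + X](mulr0 (- phi s x)).
  apply: is_deriv_onM; first by apply: is_deriv_onN; exact: dphiE.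
  have := @is_deriv_on_affine R t0 T 0 (rho x) s.
  by under eq_fun do rewrite mul0r add0r.
have vE s : t0 <= s <= T -> value D T vel F G q rho s = torus_int (h s).
  move=> sT; have t0s : t0 <= s by case/andP: sT.
  apply: value_pairing => //; first exact: C12_subset cphi.
  exact: hj_equation_subset hphi.
have -> : hamiltonian1 D vel F rho (phi t) (q t) = torus_int (h' t).
  congr torus_int; apply/funext => x; rewrite /h'.
  have [p dp pE] := hphi.1 t x t0tT.
  rewrite -(is_deriv_on_unique t0T t0tT dp (dphiE t x t0tT)) -pE; ring.
have := is_deriv_on_torus_int t0T ch ch' dh t0tT.
rewrite /is_deriv_on -vE//; apply: cvg_trans; apply: near_eq_cvg.
exists 1 => //= r _ _; rewrite in_itv/= => t0rT.
by rewrite (vE r).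
Qed.

End ValueFunction.

End MFG.

(* V is the normed space of vorticity fields, vort realizes its elements as
   scalar fields on the torus, and vel is the operator q |-> u. *)
Theorem proposition5 (R : realType) (d : nat) (hd : (0 < d <= 2)%N)
  (V : normedModType R)
  (vort : {linear V -> ('rV[R]_d -> R^o)}) (vort_inj : injective vort)
  (vort_per : forall w : V, torus_periodic (vort w))
  (vel : {linear V -> ('rV[R]_d -> 'rV[R]_d)}) (vel_inj : injective vel)
  (vel_per : forall w : V, torus_periodic (vel w))
  (vel_C1 : forall (w : V) (i : 'I_d), C1 (vcoord (vel w) i))
  (vel_incompressible : forall (w : V) (x : 'rV[R]_d), divg (vel w) x = 0)
  (F G : 'rV[R]_d -> V -> R)
  (F_per : forall w : V, torus_periodic (F^~ w))
  (G_per : forall w : V, torus_periodic (G^~ w))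
  (D : R) (D_ge0 : 0 <= D)
  (t0 T : R) (t0T : t0 < T)
  (q : R -> V) (q_ac : abs_continuous_curve t0 T q)
  (minimizer_is_solution :
    forall (rho : 'rV[R]_d -> R) (t : R), density rho -> t0 <= t <= T ->
      exists r phi : R -> 'rV[R]_d -> R,
        mfg1_solution D T vel F G q t rho r phi /\
        is_minimizer D T vel F G q t rho r (fun s => grad (phi s))) :
  [/\ (forall (rho : 'rV[R]_d -> R) (t : R) (r phi : R -> 'rV[R]_d -> R),
        density rho -> t0 <= t <= T ->
        mfg1_solution D T vel F G q t rho r phi ->
        is_minimizer D T vel F G q t rho r (fun s => grad (phi s)) ->
        forall s : R, t <= s <= T ->
          has_first_variation (fun m => value D T vel F G q m s) (r s) /\
          forall x : 'rV[R]_d,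
            phi s x
            = - first_variation (fun m => value D T vel F G q m s) (r s) x),
      (forall (rho : 'rV[R]_d -> R) (t : R), density rho -> t0 <= t <= T ->
        has_first_variation (fun m => value D T vel F G q m t) rho /\
        exists2 Ut : R,
          is_deriv_on t0 T (fun s => value D T vel F G q rho s) t Ut &
          Ut - hamiltonian1 D vel F rho
                 (fun x =>
                   - first_variation (fun m => value D T vel F G q m t) rho x)
                 (q t) = 0) &
      (forall rho : 'rV[R]_d -> R, density rho ->
        value D T vel F G q rho T
        = torus_int (fun x => G x (q T) * rho x))].

Proof.
split.
- move=> rho t r phi drho t0tT [_ cphi _ hphi] [[_ dr _ _ _] _] s stT.
  have [t0s ts] : t0 <= s <= T /\ t <= s by lra.
  have fv := value_first_variation vel_per vel_C1 D_ge0 minimizer_is_solution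
    t0s (dr s stT) (C12_subset ts cphi) (hj_equation_subset ts hphi).
  split; first by exists (fun x => - phi s x).
  by move=> x; rewrite (first_variationE (dr s stT) fv) opprK.
- move=> rho t drho t0tT.
  have t0t0T : t0 <= t0 <= T by lra.
  (* The solution is started at [t0] and not at [t]: the time derivative on [[t0, T]] also compares
     with values at times before [t]. *)
  have [r [phi [[_ cphi _ hphi] _]]] := minimizer_is_solution rho t0 drho t0t0T.
  have t0t : t0 <= t by case/andP: t0tT.
  have fv := value_first_variation vel_per vel_C1 D_ge0 minimizer_is_solution
    t0tT drho (C12_subset t0t cphi) (hj_equation_subset t0t hphi).
  split; first by exists (fun x => - phi t x).
  exists (hamiltonian1 D vel F rho (phi t) (q t)).
    exact: (value_time_derivative vel_per vel_C1 D_ge0 minimizer_is_solution).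
  rewrite (first_variationE drho fv).
  have -> : (fun x => - - phi t x) = phi t by apply/funext => x; rewrite opprK.
  exact: subrr.
- by move=> rho drho; apply: (value_terminal minimizer_is_solution) => //; exact: ltW.
Qed.
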